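(* Let $\mathfrak{g}$ be a compact semisimple (real) Lie algebra, let $\mathfrak{h}$ be a Lie subalgebra of $\mathfrak{g}$, and let $\phi$ be a finite-dimensional faithful complex matrix representation of $\mathfrak{g}$. Then the following statements are equivalent: (1) $\mathfrak{h}=\mathfrak{g}$; (2) $\dim(\mathrm{com}[(\phi\otimes\bar\phi)|_{\mathfrak{h}}])=\dim(\mathrm{com}[\phi\otimes\bar\phi])$; (3) $\dim(\mathrm{com}[(\phi\otimes\phi)|_{\mathfrak{h}}])=\dim(\mathrm{com}[\phi\otimes\phi])$; (4) $\|(\phi\otimes\bar\phi)|_{\mathfrak{h}}\|_2=\|\phi\otimes\bar\phi\|_2$; (5) $\|(\phi\otimes\bar\phi)|_{\mathfrak{h}}\|_1=\|\phi\otimes\bar\phi\|_1$; (6) $\|(\phi\otimes\phi)|_{\mathfrak{h}}\|_2=\|\phi\otimes\phi\|_2$; (7) $\|(\phi\otimes\phi)|_{\mathfrak{h}}\|_1=\|\phi\otimes\phi\|_1$.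
   Context: All representations are finite-dimensional matrix representations with complex entries. For representations $\phi,\psi$ of a Lie algebra $\mathfrak{g}$, the tensor product is $(\phi\otimes\psi)(g)=\phi(g)\otimes \mathbb{1}_{\dim\psi}+\mathbb{1}_{\dim\phi}\otimes\psi(g)$, and the dual representation is $\bar\phi(g)=-\phi(g)^T$. For a representation $\psi$, $\mathrm{com}[\psi]$ (the commutant) is the space of all complex $\dim\psi\times\dim\psi$ matrices commuting with $\psi(g)$ for all $g$ in the Lie algebra. $\psi|_{\mathfrak{h}}$ denotes restriction to the subalgebra $\mathfrak{h}$. For a semisimple (completely reducible) representation $\psi\cong\bigoplus_{i\in\mathcal I}\psi_i^{\oplus m_i}$ with pairwise inequivalent irreducible (over $\mathbb C$) representations $\psi_i$ and multiplicities $m_i$, define $\|\psi\|_1=\sum_{i} m_i$ and $\|\psi\|_2=\sum_i m_i^2$. *)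

(* Defs.v *)
From HB Require Import structures.
From mathcomp Require Import all_boot all_order all_algebra.
From mathcomp Require Import complex mxtens.
From mathcomp Require Import boolp classical_sets reals.

Set Implicit Arguments.
Unset Strict Implicit.
Unset Printing Implicit Defensive.

Import Order.TTheory GRing.Theory Num.Theory.
Local Open Scope ring_scope.

Section LieAlgebra.
Variables (R : realType) (g : vectType R) (br : g -> g -> g).

Definition is_lie_bracket : Prop :=
  [/\ (forall (a : R) (x y z : g), br (a *: x + y) z = a *: br x z + br y z),
      (forall (a : R) (x y z : g), br x (a *: y + z) = a *: br x y + br x z),
      (forall x : g, br x x = 0) &
      (forall x y z : g, br x (br y z) + br y (br z x) + br z (br x y) = 0)].

Definition lie_subalgebra (h : {vspace g}) : Prop :=
  forall x y, x \in h -> y \in h -> br x y \in h.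

Definition lie_ideal (I : {vspace g}) : Prop :=
  forall x y, y \in I -> br x y \in I.

Definition abelian_subspace (I : {vspace g}) : Prop :=
  forall x y, x \in I -> y \in I -> br x y = 0.

Definition semisimple : Prop :=
  forall I : {vspace g}, lie_ideal I -> abelian_subspace I -> I = 0%VS.

Definition compact_lie : Prop :=
  exists B : g -> g -> R,
    [/\ (forall (a : R) (x y z : g), B (a *: x + y) z = a * B x z + B y z),
        (forall x y, B x y = B y x),
        (forall x, x != 0 -> 0 < B x x) &
        (forall x y z, B (br x y) z + B y (br x z) = 0)].

Definition compact_semisimple : Prop := compact_lie /\ semisimple.

End LieAlgebra.

Section Representations.
Variables (R : realType) (g : vectType R) (br : g -> g -> g).
Local Notation C := (R[i]).

Definition is_rep n (phi : g -> 'M[C]_n) : Prop :=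
  [/\ (forall x y, phi (x + y) = phi x + phi y),
      (forall (a : R) x, phi (a *: x) = (a%:C)%C *: phi x) &
      (forall x y, phi (br x y) = phi x *m phi y - phi y *m phi x)].

Definition faithful n (phi : g -> 'M[C]_n) : Prop := injective phi.

Definition tens_rep m n (phi : g -> 'M[C]_m) (psi : g -> 'M[C]_n)
  : g -> 'M[C]_(m * n) :=
  fun x => phi x *t (1%:M : 'M[C]_n) + (1%:M : 'M[C]_m) *t psi x.

Definition dual_rep n (phi : g -> 'M[C]_n) : g -> 'M[C]_n :=
  fun x => - (phi x)^T.

(* In what follows, a representation psi of g and a subspace S of g
   (S = h for the restriction psi|_h, S = fullv for psi itself) are given;
   the "representation psi restricted to S" is psi on the elements of S. *)
Variables (N : nat) (psi : g -> 'M[C]_N) (S : {vspace g}).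

Definition commutant : set 'M[C]_N :=
  [set X | forall x, x \in S -> X *m psi x = psi x *m X].

End Representations.

Definition dim_set (K : fieldType) (vT : vectType K) (A : set vT) : nat :=
  \max_(k < (\dim (fullv : {vspace vT})).+1 |
          `[< exists s : seq vT, [/\ size s = k, free s & forall v, v \in s -> A v] >])
    k.

Section Decomposition.
Variables (R : realType) (g : vectType R).
Local Notation C := (R[i]).
Variables (N : nat) (psi : g -> 'M[C]_N) (S : {vspace g}).

Definition invariant (U : {vspace 'cV[C]_N}) : Prop :=
  forall x, x \in S -> forall v, v \in U -> psi x *m v \in U.

Definition irreducible_sub (U : {vspace 'cV[C]_N}) : Prop :=
  [/\ U != 0%VS, invariant U &
      forall W : {vspace 'cV[C]_N}, (W <= U)%VS -> invariant W ->
        W = 0%VS \/ W = U].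

Definition equiv_sub (U V : {vspace 'cV[C]_N}) : Prop :=
  exists T : 'M[C]_N,
    [/\ forall v, v \in U -> T *m v \in V,
        forall v, v \in U -> T *m v = 0 -> v = 0,
        \dim U = \dim V &
        forall x, x \in S -> forall v, v \in U ->
          T *m (psi x *m v) = psi x *m (T *m v)].

Definition irr_decomp (Us : seq {vspace 'cV[C]_N}) : Prop :=
  [/\ forall U, U \in Us -> irreducible_sub U,
      directv (\sum_(U <- Us) U) &
      (\sum_(U <- Us) U)%VS = fullv].

Definition the_decomp : seq {vspace 'cV[C]_N} := xget [::] irr_decomp.

(* ||psi|_S||_1 = sum_i m_i = number of irreducible summands *)
Definition norm1 : nat := size the_decomp.

(* ||psi|_S||_2 = sum_i m_i^2 = number of ordered pairs (U, U') of summands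
   of the decomposition carrying equivalent irreducible representations *)
Definition norm2 : nat :=
  \sum_(i < size the_decomp) \sum_(j < size the_decomp)
     (`[< equiv_sub (nth 0%VS the_decomp i) (nth 0%VS the_decomp j) >] : nat).

End Decomposition.

(* Main.v *)
(* Every representation X of g is conjugate to a skew-Hermitian one. If X is
   irreducible, minimise sum_e |G X_e G^-1|^2 over invertible G, with e running
   through an orthonormal basis of g; the minimum exists because, once G is
   normalised, irreducibility keeps limits of such G invertible. At a minimum
   sum_e [X_e, X_e^* ] = 0, and this forces the Hermitian parts of the X_e to
   commute with X; they vanish since g is perfect. The reducible case follows
   because the cocycle glueing two skew-Hermitian blocks is a coboundary.

   Hence the tensor squares psi are completely reducible over g and over h.
   Each of the six numerical equalities implies that an operator which preserves
   all g-submodules and commutes with psi(h) commutes with psi(g): for the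
   commutants and the norms ||.||_2 (equal to dimensions of commutants, by Schur)
   because the commutants of h and g coincide, and for ||.||_1 because each
   g-irreducible summand stays h-irreducible, so that Schur's lemma makes such an
   operator scalar on it.

   Apply this to the Casimir element sum_f psi(f)^2 of h for the trace form, and
   pair the resulting identity with phi(z) (x) chi(y): every x orthogonal to h
   commutes with h. Apply it again to psi(x): x is central in g, so x = 0. *)
Require Import Defs.
From HB Require Import structures.
From mathcomp Require Import all_boot all_order all_algebra.
From mathcomp Require Import complex mxtens.
From mathcomp Require Import boolp classical_sets reals.
From mathcomp Require Import topology normedtype derive.
From mathcomp Require Import ring lra zify.

Set Implicit Arguments.
Unset Strict Implicit.
Unset Printing Implicit Defensive.

Import Order.TTheory GRing.Theory Num.Theory.
Import numFieldTopology.Exports numFieldNormedType.Exports.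
Local Open Scope ring_scope.
Local Notation Re := complex.Re.
Local Notation Im := complex.Im.

(** * Conjugate transposes and the Hilbert-Schmidt inner product *)

Section Adjoint.
Variable R : realType.
Local Notation C := (R[i]).

Definition adjmx m n (A : 'M[C]_(m, n)) : 'M[C]_(n, m) := (map_mx conjc A)^T.

Lemma adjmxE m n (A : 'M[C]_(m, n)) i j : adjmx A i j = conjc (A j i).
Proof. by rewrite !mxE. Qed.

Lemma adjmxK m n (A : 'M[C]_(m, n)) : adjmx (adjmx A) = A.
Proof. by apply/matrixP=> i j; rewrite !adjmxE conjcK. Qed.

Lemma adjmxD m n (A B : 'M[C]_(m, n)) : adjmx (A + B) = adjmx A + adjmx B.
Proof. by rewrite /adjmx map_mxD linearD. Qed.

Lemma adjmxN m n (A : 'M[C]_(m, n)) : adjmx (- A) = - adjmx A.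
Proof. by rewrite /adjmx map_mxN linearN. Qed.

Lemma adjmxB m n (A B : 'M[C]_(m, n)) : adjmx (A - B) = adjmx A - adjmx B.
Proof. by rewrite adjmxD adjmxN. Qed.

Lemma adjmxZ m n a (A : 'M[C]_(m, n)) : adjmx (a *: A) = conjc a *: adjmx A.
Proof. by rewrite /adjmx map_mxZ linearZ. Qed.

Lemma adjmxM m n p (A : 'M[C]_(m, n)) (B : 'M[C]_(n, p)) :
  adjmx (A *m B) = adjmx B *m adjmx A.
Proof. by rewrite /adjmx map_mxM trmx_mul. Qed.

Lemma adjmx0 m n : adjmx (0 : 'M[C]_(m, n)) = 0.
Proof. by rewrite /adjmx map_mx0 trmx0. Qed.

Lemma adjmx_sum m n I (r : seq I) (F : I -> 'M[C]_(m, n)) :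
  adjmx (\sum_(i <- r) F i) = \sum_(i <- r) adjmx (F i).
Proof. exact: (big_morph _ (@adjmxD _ _) (adjmx0 _ _)). Qed.

Lemma adjmx_block m1 m2 n1 n2 (A : 'M[C]_(m1, n1)) B (D : 'M[C]_(m2, n1)) E :
  adjmx (block_mx A B D E : 'M_(m1 + m2, n1 + n2)) =
  block_mx (adjmx A) (adjmx D) (adjmx B) (adjmx E).
Proof. by rewrite /adjmx map_block_mx tr_block_mx. Qed.

Lemma mxtrace_adj n (A : 'M[C]_n) : \tr (adjmx A) = conjc (\tr A).
Proof.
by rewrite /mxtrace rmorph_sum; apply: eq_bigr => i _; rewrite adjmxE.
Qed.

(** Conjugate-linear in the first argument, so that [adjmx A] is the adjoint of multiplication by
    A. *)
Definition hs m n (A B : 'M[C]_(m, n)) : C := \tr (adjmx A *m B).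

Lemma hsE m n (A : 'M[C]_(m, n)) : hs A A = \sum_i \sum_j `|A i j| ^+ 2.
Proof.
rewrite /hs /mxtrace exchange_big /=; apply: eq_bigr => i _.
rewrite mxE; apply: eq_bigr => j _; rewrite adjmxE -add_Re2_Im2.
by case: (A j i) => a b; simpc; rewrite [b * a]mulrC subrr !expr2.
Qed.

Lemma hs_ge0 m n (A : 'M[C]_(m, n)) : 0 <= hs A A.
Proof.
by rewrite hsE; apply: sumr_ge0 => i _; apply: sumr_ge0 => j _; rewrite exprn_ge0.
Qed.

Lemma hs_eq0 m n (A : 'M[C]_(m, n)) : hs A A = 0 -> A = 0.
Proof.
rewrite hsE => /eqP; rewrite psumr_eq0 => [/allP H|i _]; last first.
  by apply: sumr_ge0 => j _; rewrite exprn_ge0.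
apply/matrixP => i j; have := H i (mem_index_enum i).
rewrite psumr_eq0 => [/allP /(_ j (mem_index_enum j))|k _]; last exact: exprn_ge0.
by rewrite expf_eq0 normr_eq0 /= mxE => /eqP.
Qed.

Lemma hsDr m n (A B D : 'M[C]_(m, n)) : hs A (B + D) = hs A B + hs A D.
Proof. by rewrite /hs mulmxDr mxtraceD. Qed.

Lemma hsDl m n (A B D : 'M[C]_(m, n)) : hs (A + B) D = hs A D + hs B D.
Proof. by rewrite /hs adjmxD mulmxDl mxtraceD. Qed.

Lemma hsNr m n (A B : 'M[C]_(m, n)) : hs A (- B) = - hs A B.
Proof. by rewrite /hs mulmxN raddfN. Qed.

Lemma hsNl m n (A B : 'M[C]_(m, n)) : hs (- A) B = - hs A B.
Proof. by rewrite /hs adjmxN mulNmx raddfN. Qed.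

Lemma hsBr m n (A B D : 'M[C]_(m, n)) : hs A (B - D) = hs A B - hs A D.
Proof. by rewrite hsDr hsNr. Qed.

Lemma hsZr m n a (A B : 'M[C]_(m, n)) : hs A (a *: B) = a * hs A B.
Proof. by rewrite /hs -scalemxAr mxtraceZ. Qed.

Lemma hsZl m n a (A B : 'M[C]_(m, n)) : hs (a *: A) B = conjc a * hs A B.
Proof. by rewrite /hs adjmxZ -scalemxAl mxtraceZ. Qed.

Lemma hs0r m n (A : 'M[C]_(m, n)) : hs A 0 = 0.
Proof. by rewrite /hs mulmx0 mxtrace0. Qed.

Lemma hs0l m n (A : 'M[C]_(m, n)) : hs 0 A = 0.
Proof. by rewrite /hs adjmx0 mul0mx mxtrace0. Qed.

Lemma hs_sumr m n I (r : seq I) (A : 'M[C]_(m, n)) F :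
  hs A (\sum_(i <- r) F i) = \sum_(i <- r) hs A (F i).
Proof. exact: (big_morph _ (@hsDr _ _ A) (hs0r A)). Qed.

Lemma hs_conj m n (A B : 'M[C]_(m, n)) : hs B A = conjc (hs A B).
Proof. by rewrite /hs -mxtrace_adj adjmxM adjmxK. Qed.

Lemma hsMl m n p (A : 'M[C]_(m, n)) (B : 'M[C]_(n, p)) D :
  hs (A *m B) D = hs B (adjmx A *m D).
Proof. by rewrite /hs adjmxM mulmxA. Qed.

Lemma hsMr m n p (A : 'M[C]_(m, n)) (B : 'M[C]_(n, p)) D :
  hs (A *m B) D = hs A (D *m adjmx B).
Proof. by rewrite /hs adjmxM -mulmxA mxtrace_mulC mulmxA. Qed.

Lemma psum_eq0 (I : eqType) (r : seq I) (F : I -> C) :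
  (forall i, 0 <= F i) -> \sum_(i <- r) F i = 0 -> forall i, i \in r -> F i = 0.
Proof.
move=> F0 /eqP; rewrite psumr_eq0 => [/allP H i ir|i _]; last exact: F0.
by apply/eqP; apply: (H i ir).
Qed.

End Adjoint.

(** * Subspaces cut out by predicates *)

Section LinearAlgebra.
Variable K : fieldType.

(** A subspace of largest dimension among those contained in P is all of P: a further vector of P
    could be added to it. *)
Lemma vspace_of_submod (vT : vectType K) (P : vT -> Prop) :
  P 0 -> (forall a x y, P x -> P y -> P (a *: x + y)) ->
  exists U : {vspace vT}, forall x, x \in U <-> P x.
Proof.
move=> P0 PZ.
pose ok d := `[< exists U : {vspace vT}, (forall x, x \in U -> P x) /\ \dim U = d >].
have ex : exists d, ok d.
  exists 0%N; apply/asboolP; exists 0%VS; rewrite dimv0; split=> // x.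
  by rewrite memv0 => /eqP ->.
have bd d : ok d -> (d <= \dim {:vT})%N.
  by move=> /asboolP[U [_ <-]]; rewrite dimvS ?subvf.
case: (ex_maxnP ex bd) => d /asboolP[U [UP dU]] dmax.
exists U => x; split=> [/UP //|Px]; apply: contrapT => /negP xU.
have okS : ok (\dim (<[x]> + U)%VS).
  apply/asboolP; exists (<[x]> + U)%VS; split=> // y /memv_addP[_ /vlineP[k ->]].
  by case=> u /UP Pu ->; apply: PZ.
have := dmax _ okS; rewrite -dU leqNgt => /negP; apply.
rewrite ltn_neqAle dimvS ?addvSr // andbT.
apply/negP => /eqP e; move/negP: xU; apply.
have /eqP -> : U == (<[x]> + U)%VS by rewrite eqEdim addvSr -e leqnn.
by apply: (subvP (addvSl _ _)); exact: memv_line.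
Qed.

End LinearAlgebra.

(** * Real inner products and orthonormal frames *)

Section InnerProduct.
Variables (R : realType) (g : vectType R) (B : g -> g -> R).
Local Notation C := (R[i]).

Definition inner_product : Prop :=
  [/\ (forall (a : R) (x y z : g), B (a *: x + y) z = a * B x z + B y z),
      (forall x y, B x y = B y x) &
      (forall x, x != 0 -> 0 < B x x)].

Hypothesis ipB : inner_product.

Let BPl a x y z : B (a *: x + y) z = a * B x z + B y z.
Proof. by case: ipB. Qed.

Lemma ip_sym x y : B x y = B y x.
Proof. by case: ipB. Qed.

Lemma ipDl x y z : B (x + y) z = B x z + B y z.
Proof. by have := BPl 1 x y z; rewrite scale1r mul1r. Qed.

Lemma ip0l z : B 0 z = 0.
Proof. by have := ipDl 0 0 z; rewrite addr0 => /eqP; rewrite -subr_eq subrr => /eqP. Qed.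

Lemma ipZl a x z : B (a *: x) z = a * B x z.
Proof. by have := BPl a x 0 z; rewrite ip0l !addr0. Qed.

Lemma ipNl x z : B (- x) z = - B x z.
Proof. by rewrite -scaleN1r ipZl mulN1r. Qed.

Lemma ipBl x y z : B (x - y) z = B x z - B y z.
Proof. by rewrite ipDl ipNl. Qed.

Lemma ip_suml I (r : seq I) (F : I -> g) z :
  B (\sum_(i <- r) F i) z = \sum_(i <- r) B (F i) z.
Proof. exact: (big_morph (fun x => B x z) (fun x y => ipDl x y z) (ip0l z)). Qed.

Lemma ipDr x y z : B z (x + y) = B z x + B z y.
Proof. by rewrite ip_sym ipDl !(ip_sym z). Qed.

Lemma ipZr a x z : B z (a *: x) = a * B z x.
Proof. by rewrite ip_sym ipZl ip_sym. Qed.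

Lemma ipNr x z : B z (- x) = - B z x.
Proof. by rewrite ip_sym ipNl ip_sym. Qed.

Lemma ip_sumr I (r : seq I) (F : I -> g) z :
  B z (\sum_(i <- r) F i) = \sum_(i <- r) B z (F i).
Proof. by rewrite ip_sym ip_suml; apply: eq_bigr => i _; rewrite ip_sym. Qed.

Lemma ip_eq0 x : B x x = 0 -> x = 0.
Proof.
move=> Bx; case: (eqVneq x 0) => // nzx; case: ipB => _ _ /(_ x nzx).
by rewrite Bx ltxx.
Qed.

(** Gram-Schmidt by induction on the dimension: normalise a nonzero vector of U and continue in its
    orthogonal complement within U. The frame is described only by the expansion of vectors of U,
    which is what later sums over it use. *)
Lemma ip_frame (U : {vspace g}) :
  exists s : seq g, {subset s <= U} /\
    forall x, x \in U -> x = \sum_(e <- s) B x e *: e.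
Proof.
have [d] := ubnP (\dim U); elim: d U => // d IH U dU.
have [->|nzU] := eqVneq U 0%VS.
  by exists [::]; split=> // x; rewrite memv0 => /eqP->; rewrite big_nil.
pose v := vpick U; have nzv : v != 0 by rewrite vpick0.
have Bv : 0 < B v v by case: ipB => _ _; apply.
pose e := (Num.sqrt (B v v))^-1 *: v.
have eU : e \in U by rewrite memvZ ?memv_pick.
have Bee : B e e = 1.
  rewrite /e ipZl ipZr mulrA -invfM -expr2 sqr_sqrtr ?ltW // mulVf //.
  by rewrite gt_eqF.
have [W WE] : exists W : {vspace g}, forall x, x \in W <-> (x \in U) /\ B x e = 0.
  apply: vspace_of_submod => [|a x y [xU Bx] [yU By]].
    by rewrite mem0v ip0l.
  by rewrite BPl Bx By mulr0 addr0 memvD ?memvZ.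
have WU : (W <= U)%VS by apply/subvP => x /WE[].
have [|s [sW sE]] := IH W.
  apply: (leq_trans _ (dU : (\dim U <= d)%N)).
  rewrite ltn_neqAle dimvS // andbT; apply/negP => /eqP dWU.
  have /eqP WUe : W == U by rewrite eqEdim WU dWU leqnn.
  by move: eU; rewrite -WUe => /WE[_ /eqP]; rewrite Bee oner_eq0.
exists (e :: s); split=> [x|x xU].
  by rewrite inE => /orP[/eqP->//|/sW]; apply: (subvP WU).
have xW : x - B x e *: e \in W.
  apply/WE; split; first by apply: rpredB => //; apply: rpredZ.
  by rewrite ipBl ipZl Bee mulr1 subrr.
rewrite big_cons -[LHS](subrK (B x e *: e)) addrC; congr (_ + _).
rewrite {1}(sE _ xW) !big_seq; apply: eq_bigr => y ys; congr (_ *: _).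
have [_ Bye] := (WE y).1 (sW _ ys).
by rewrite ipBl ipZl (ip_sym e) Bye mulr0 subr0.
Qed.

Lemma ip_split (U : {vspace g}) x :
  exists y z, [/\ x = y + z, y \in U & forall u, u \in U -> B z u = 0].
Proof.
have [s [sU sE]] := ip_frame U.
exists (\sum_(e <- s) B x e *: e), (x - \sum_(e <- s) B x e *: e).
split=> [||u uU]; first by rewrite addrC subrK.
  by rewrite big_seq memv_suml // => e /sU eU; rewrite memvZ.
rewrite ipBl ip_suml [in B x u](sE u uU) ip_sumr -sumrB big1 // => e _.
by rewrite ipZl ipZr (ip_sym u) mulrC subrr.
Qed.

(* The operator of a skew map D is antisymmetric in the frame, so transposing
   the two slots of beta changes the sign. *)
Lemma skew_frame_sum (V : lmodType C) (U : {vspace g}) (s : seq g)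
    (D : g -> g) (beta : g -> g -> V) :
  {subset s <= U} -> (forall x, x \in U -> x = \sum_(e <- s) B x e *: e) ->
  (forall x, x \in U -> D x \in U) ->
  (forall x y, x \in U -> y \in U -> B (D x) y = - B x (D y)) ->
  (forall a x y z, beta (a *: x + y) z = a%:C%C *: beta x z + beta y z) ->
  (forall a x y z, beta z (a *: x + y) = a%:C%C *: beta z x + beta z y) ->
  \sum_(e <- s) beta e (D e) = - \sum_(e <- s) beta (D e) e.
Proof.
move=> sU sE DU Dskew bl br.
have bl0 z : beta 0 z = 0.
  by have := bl (-1) 0 0 z; rewrite scaler0 addr0 rmorphN1 scaleN1r addNr.
have br0 z : beta z 0 = 0.
  by have := br (-1) 0 0 z; rewrite scaler0 addr0 rmorphN1 scaleN1r addNr.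
have blS (F : g -> R) z (r : seq g) :
    beta (\sum_(f <- r) F f *: f) z = \sum_(f <- r) (F f)%:C%C *: beta f z.
  by elim: r => [|f r IHr]; rewrite ?big_nil ?big_cons ?bl0 // bl IHr.
have brS (F : g -> R) z (r : seq g) :
    beta z (\sum_(f <- r) F f *: f) = \sum_(f <- r) (F f)%:C%C *: beta z f.
  by elim: r => [|f r IHr]; rewrite ?big_nil ?big_cons ?br0 // br IHr.
transitivity (\sum_(e <- s) \sum_(f <- s) (B (D e) f)%:C%C *: beta e f).
  rewrite !big_seq; apply: eq_bigr => e es.
  by rewrite {1}(sE _ (DU _ (sU _ es))) brS.
rewrite exchange_big /= -sumrN !big_seq; apply: eq_bigr => f fs.
rewrite [in RHS](sE _ (DU _ (sU _ fs))) blS -sumrN !big_seq.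
apply: eq_bigr => e es; rewrite Dskew ?sU // ip_sym.
by rewrite rmorphN scaleNr.
Qed.

End InnerProduct.

(** * Centre and derived algebra of a semisimple Lie algebra *)

Section LieBasics.
Variables (R : realType) (g : vectType R) (br : g -> g -> g).
Local Notation C := (R[i]).
Hypothesis lie : is_lie_bracket br.

Lemma lieDl x y z : br (x + y) z = br x z + br y z.
Proof. by case: lie => H _ _ _; have := H 1 x y z; rewrite !scale1r. Qed.

Lemma lieDr x y z : br x (y + z) = br x y + br x z.
Proof. by case: lie => _ H _ _; have := H 1 x y z; rewrite !scale1r. Qed.

Lemma liexx x : br x x = 0. Proof. by case: lie. Qed.

Lemma lieC x y : br x y = - br y x.
Proof.
have := liexx (x + y); rewrite lieDl !lieDr !liexx add0r addr0.
by move/eqP; rewrite addr_eq0 => /eqP.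
Qed.

Lemma lie0r x : br x 0 = 0.
Proof. by have := lieDr x 0 0; rewrite addr0 => /eqP; rewrite -subr_eq subrr => /eqP. Qed.

Lemma lie0l x : br 0 x = 0. Proof. by rewrite lieC lie0r oppr0. Qed.

(** The centre is an abelian ideal. *)
Lemma semisimple_centerless x :
  semisimple br -> (forall y, br x y = 0) -> x = 0.
Proof.
move=> ss xc.
have [Z ZE] : exists Z : {vspace g}, forall x, x \in Z <-> forall y, br x y = 0.
  apply: vspace_of_submod => [y|a u v uc vc y]; first exact: lie0l.
  by case: lie => -> _ _ _; rewrite uc vc scaler0 addr0.
have Z0 : Z = 0%VS.
  apply: ss => [u v /ZE vc|u v /ZE uc _ //].
  by rewrite lieC vc oppr0 mem0v.
by apply/eqP; rewrite -memv0 -Z0; apply/ZE.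
Qed.

(** The algebra is perfect: an element orthogonal to the subspace P, hence to all brackets, is
    central by invariance of B, so it vanishes. *)
Lemma perfect_ind (P : g -> Prop) : compact_semisimple br ->
  P 0 -> (forall a x y, P x -> P y -> P (a *: x + y)) ->
  (forall x y, P (br x y)) -> forall x, P x.
Proof.
move=> [[B [B1 B2 B3 B4]] ss] P0 PZ Pbr x.
have ipB : inner_product B by split.
have [U UE] := vspace_of_submod P0 PZ.
have [y [z [-> /UE Py zU]]] := ip_split ipB U x.
suff -> : z = 0 by rewrite addr0.
apply: semisimple_centerless => // w; apply: (ip_eq0 ipB).
have := B4 w z (br z w); rewrite zU; last by apply/UE.
by rewrite addr0 (lieC z) (ipNl ipB) => ->; rewrite oppr0.
Qed.

End LieBasics.

(** * Unitarizability *)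

Section Compactness.
Variables (R : realType) (n d : nat).
Local Notation C := (R[i]).
Local Notation T := (option 'I_d * 'I_n * 'I_n * bool)%type.
Local Notation N := #|{: T}|.

(* A row vector z encodes d + 1 complex matrices: [block z None] will be the
   conjugating matrix and [block z (Some k)] the conjugate of the k-th matrix; the
   boolean selects the real (false) or imaginary (true) part of an entry. *)
Definition coef (z : 'rV[R]_N) (t : T) : R := z 0 (enum_rank t).

Definition block (z : 'rV[R]_N) (o : option 'I_d) : 'M[C]_n :=
  \matrix_(i, j) Complex (coef z (o, i, j, false)) (coef z (o, i, j, true)).

Lemma block_surj (F : option 'I_d -> 'M[C]_n) : exists z, block z = F.
Proof.
exists (\row_t let: (o, i, j, b) := enum_val t in
   if b then Im (F o i j) else Re (F o i j)).
apply: funext => o; apply/matrixP => i j.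
by rewrite !mxE /coef !mxE !enum_rankK; case: (F o i j).
Qed.

(** Continuity is split into real and imaginary parts, so that only the topology of [R] is needed on
    the target. *)
Definition ccont (f : 'rV[R]_N -> C) : Prop :=
  continuous (fun z => Re (f z)) /\ continuous (fun z => Im (f z)).

Lemma coef_continuous t : continuous (fun z => coef z t).
Proof. exact: coord_continuous. Qed.

Lemma ccont_cst c : ccont (fun=> c).
Proof. by split=> z; exact: cst_continuous. Qed.

Lemma row_continuousD (f h : 'rV[R]_N -> R) :
  continuous f -> continuous h -> continuous (fun z => f z + h z).
Proof. by move=> cf ch z; exact: (continuousD (cf z) (ch z)). Qed.

Lemma row_continuousM (f h : 'rV[R]_N -> R) :
  continuous f -> continuous h -> continuous (fun z => f z * h z).
Proof. by move=> cf ch z; exact: (continuousM (cf z) (ch z)). Qed.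

Lemma row_continuousB (f h : 'rV[R]_N -> R) :
  continuous f -> continuous h -> continuous (fun z => f z - h z).
Proof. by move=> cf ch z; exact: (continuousB (cf z) (ch z)). Qed.

Lemma ccontD f h : ccont f -> ccont h -> ccont (fun z => f z + h z).
Proof.
move=> [f1 f2] [h1 h2]; split.
- rewrite (_ : (fun _ => _) = (fun z => Re (f z) + Re (h z))); first exact: row_continuousD.
  by apply: funext => w; case: (f w) (h w) => [? ?] [? ?].
- rewrite (_ : (fun _ => _) = (fun z => Im (f z) + Im (h z))); first exact: row_continuousD.
  by apply: funext => w; case: (f w) (h w) => [? ?] [? ?].
Qed.

Lemma ccontM f h : ccont f -> ccont h -> ccont (fun z => f z * h z).
Proof.
move=> [f1 f2] [h1 h2]; split.
- rewrite (_ : (fun _ => _) =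
      (fun z => Re (f z) * Re (h z) - Im (f z) * Im (h z))).
    by apply: row_continuousB; apply: row_continuousM.
  by apply: funext => w; case: (f w) (h w) => [? ?] [? ?].
- rewrite (_ : (fun _ => _) =
      (fun z => Re (f z) * Im (h z) + Im (f z) * Re (h z))).
    by apply: row_continuousD; apply: row_continuousM.
  by apply: funext => w; case: (f w) (h w) => [? ?] [? ?].
Qed.

Lemma ccont_sum I (r : seq I) (F : I -> 'rV[R]_N -> C) :
  (forall i, ccont (F i)) -> ccont (fun z => \sum_(i <- r) F i z).
Proof.
move=> cF; elim: r => [|i r IHr].
  rewrite (_ : (fun _ => _) = fun=> 0); first exact: ccont_cst.
  by apply: funext => z; rewrite big_nil.
rewrite (_ : (fun _ => _) = fun z => F i z + \sum_(i <- r) F i z).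
  exact: ccontD.
by apply: funext => z; rewrite big_cons.
Qed.

Lemma continuous_sum I (r : seq I) (F : I -> 'rV[R]_N -> R) :
  (forall i, continuous (F i)) -> continuous (fun z => \sum_(i <- r) F i z).
Proof.
move=> cF; elim: r => [|i r IHr].
  rewrite (_ : (fun _ => _) = fun=> 0); first by move=> z; exact: cst_continuous.
  by apply: funext => w; rewrite big_nil.
rewrite (_ : (fun _ => _) = fun z => F i z + \sum_(i <- r) F i z).
  exact: row_continuousD.
by apply: funext => w; rewrite big_cons.
Qed.

Lemma ccont_block o i j : ccont (fun z => block z o i j).
Proof.
split.
- rewrite (_ : (fun _ => _) = fun z => coef z (o, i, j, false)).
    exact: coef_continuous.
  by apply: funext => w; rewrite mxE.
- rewrite (_ : (fun _ => _) = fun z => coef z (o, i, j, true)).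
    exact: coef_continuous.
  by apply: funext => w; rewrite mxE.
Qed.

Lemma ccont_mulmx (F H : 'rV[R]_N -> 'M[C]_n) :
  (forall i j, ccont (fun z => F z i j)) ->
  (forall i j, ccont (fun z => H z i j)) ->
  forall i j, ccont (fun z => (F z *m H z) i j).
Proof.
move=> cF cH i j.
rewrite (_ : (fun _ => _) = fun z => \sum_k F z i k * H z k j).
  by apply: ccont_sum => k; apply: ccontM.
by apply: funext => z; rewrite mxE.
Qed.

Definition sqn (z : 'rV[R]_N) o : R :=
  \sum_i \sum_j (coef z (o, i, j, false) ^+ 2 + coef z (o, i, j, true) ^+ 2).

Lemma hs_block z o : hs (block z o) (block z o) = (sqn z o)%:C%C.
Proof.
rewrite hsE /sqn rmorph_sum; apply: eq_bigr => i _.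
rewrite rmorph_sum; apply: eq_bigr => j _.
by rewrite mxE -add_Re2_Im2.
Qed.

Lemma sqn_continuous o : continuous (fun z => sqn z o).
Proof.
apply: continuous_sum => i; apply: continuous_sum => j.
by apply: row_continuousD; apply: row_continuousM; exact: coef_continuous.
Qed.

Lemma coef_le_sqn z o i j b : coef z (o, i, j, b) ^+ 2 <= sqn z o.
Proof.
rewrite /sqn (bigD1 i) //= (bigD1 j) //= -addrA.
have h1 : 0 <= \sum_(k | k != j)
    (coef z (o, i, k, false) ^+ 2 + coef z (o, i, k, true) ^+ 2).
  by apply: sumr_ge0 => k _; rewrite addr_ge0 ?sqr_ge0.
have h2 : 0 <= \sum_(l | l != i) \sum_k
    (coef z (o, l, k, false) ^+ 2 + coef z (o, l, k, true) ^+ 2).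
  by apply: sumr_ge0 => l _; apply: sumr_ge0 => k _; rewrite addr_ge0 ?sqr_ge0.
have h3 := sqr_ge0 (coef z (o, i, j, false)).
have h4 := sqr_ge0 (coef z (o, i, j, true)).
by case: b; lra.
Qed.

Variable A : 'I_d -> 'M[C]_n.

(** The relation [G A_k = X_k G], unlike [X_k = G A_k G^-1], is polynomial and free of inverses, so
    it is a closed condition. Normalising G and bounding the [X_k] makes the set bounded. *)
Definition intertwined (M : R) : set 'rV[R]_N :=
  [set z | [/\ sqn z None = 1,
     forall k, block z None *m A k = block z (Some k) *m block z None &
     \sum_k sqn z (Some k) <= M]]%classic.

Lemma intertwined_closed M : closed (intertwined M).
Proof.
have closed0 (f : 'rV[R]_N -> R) c : continuous f -> closed [set z | f z = c]%classic.
  move=> cf; have := @preimage_closed _ _ f [set x | x = c]%classic.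
  by apply; [move=> z _; exact: cf | exact: closed_eq].
rewrite (_ : intertwined M = [set z | sqn z None = 1]
  `&` ((\bigcap_k \bigcap_i \bigcap_j
     ([set z | Re ((block z None *m A k +
                    (- block z (Some k)) *m block z None) i j) = 0] `&`
      [set z | Im ((block z None *m A k +
                    (- block z (Some k)) *m block z None) i j) = 0]))
  `&` [set z | \sum_k sqn z (Some k) <= M]))%classic; last first.
  apply/seteqP; split=> z [] /=.
    move=> z1 z2 z3; split=> //; split=> // k _ i _ j _ /=.
    by rewrite z2 mulNmx addrN mxE.
  move=> z1 [z2 z3]; split=> // k; apply/eqP; rewrite -subr_eq0 -mulNmx.
  apply/eqP/matrixP => i j; have [/= h1 h2] := z2 k I i I j I.
  by rewrite [RHS]mxE [LHS]complexE h1 h2 mulr0 addr0.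
apply: closedI; first by apply: closed0; exact: sqn_continuous.
apply: closedI; last first.
  have := @preimage_closed _ _ (fun z => \sum_k sqn z (Some k)) [set x | x <= M]%classic.
  apply; last exact: closed_le.
  by move=> z _; apply: continuous_sum => k; exact: sqn_continuous.
apply: closed_bigI => k _; apply: closed_bigI => i _; apply: closed_bigI => j _.
have [c1 c2] : ccont (fun z =>
    (block z None *m A k + (- block z (Some k)) *m block z None) i j).
  rewrite (_ : (fun _ => _) = fun z => (block z None *m A k) i j +
      (-1) * (block z (Some k) *m block z None) i j); last first.
    by apply: funext => z; rewrite mxE mulNmx [X in _ + X]mxE mulN1r.
  apply: ccontD.
    by apply: ccont_mulmx => *; [exact: ccont_block | exact: ccont_cst].
  apply: ccontM; first exact: ccont_cst.
  by apply: ccont_mulmx => *; exact: ccont_block.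
by apply: closedI; apply: closed0.
Qed.

Lemma intertwined_compact M : compact (intertwined M).
Proof.
(* Squared coordinates are at most [1 + |M|]; since [|x| <= 1 + x ^ 2], this c bounds the
   coordinates without a square root. *)
pose c := 1 + (1 + `|M|).
have box : compact
    [set v : 'rV[R]_N | forall i, v ord0 i \in `[(- c), c]].
  apply: (@rV_compact _  _ (fun=> `[(- c), c]%classic)).
  by move=> _; apply: segment_compact.
apply: (subclosed_compact _ box) => [|z [z1 _ z3] t]; first exact: intertwined_closed.
have -> : z ord0 t = coef z (enum_val t) by rewrite /coef enum_valK.
case: (enum_val t) => [[[o i] j] b].
have h1 := coef_le_sqn z o i j b.
have sqn0 k : 0 <= sqn z k.
  by apply: sumr_ge0 => ? _; apply: sumr_ge0 => ? _; rewrite addr_ge0 ?sqr_ge0.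
have h2 : sqn z o <= 1 + `|M|.
  case: o {h1} => [k|]; last by rewrite z1 lerDl.
  have : sqn z (Some k) <= \sum_k sqn z (Some k).
    by rewrite (bigD1 k) //= lerDl sumr_ge0.
  by have := ler_norm M; lra.
rewrite in_itv /=; apply/andP.
by split; rewrite /c; move: (coef _ _) h1 h2 (normr_ge0 M) => x; nra.
Qed.

(* By irreducibility a nonzero G with G A_k = X_k G for all k is invertible: its
   row space is stable. So no invertibility has to be imposed on the compact set. *)
Lemma conjugate_min : (0 < n)%N ->
  (forall U : 'M[C]_n, (forall k, (U *m A k <= U)%MS) -> U = 0 \/ row_full U) ->
  exists P Q : 'M[C]_n, [/\ P *m Q = 1%:M, Q *m P = 1%:M &
    forall u v : 'M[C]_n, u *m v = 1%:M -> v *m u = 1%:M ->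
      \sum_k hs (P *m A k *m Q) (P *m A k *m Q) <=
      \sum_k hs (u *m (P *m A k *m Q) *m v) (u *m (P *m A k *m Q) *m v)].
Proof.
move=> n_gt0 irr.
have hsR m (P : 'M[C]_m) : hs P P = (Re (hs P P))%:C%C.
  by have /ger0_Im := hs_ge0 P; case: (hs P P) => a b /= ->.
(* Scaling u to norm 1 preserves its relations with the matrices [u A_k v], so every invertible
   conjugation is represented by a normalised point. *)
have point (u v : 'M[C]_n) : u *m v = 1%:M -> v *m u = 1%:M ->
  exists z, [/\ sqn z None = 1,
     forall k, block z None *m A k = block z (Some k) *m block z None &
     forall k, block z (Some k) = u *m A k *m v].
  move=> uv vu; set r := Re (hs u u).
  have r_gt0 : 0 < r.
    have u0 : hs u u != 0.
      apply/eqP => /hs_eq0 u0; move: uv; rewrite u0 mul0mx => /matrixP.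
      move=> /(_ (Ordinal n_gt0) (Ordinal n_gt0)); rewrite !mxE eqxx => /eqP.
      by rewrite eq_sym oner_eq0.
    by have := hs_ge0 u; rewrite le0r (negPf u0) /= hsR ltcR.
  pose c := ((Num.sqrt r)^-1)%:C%C : C.
  have [z zE] := block_surj (fun o => if o is Some k then u *m A k *m v else c *: u).
  exists z; rewrite zE; split=> //.
    apply: complexI; rewrite -hs_block zE hsZl hsZr hsR -/r conjc_real.
    rewrite -!rmorphM /= mulrA -invfM -expr2 sqr_sqrtr ?ltW //.
    by rewrite mulVf ?gt_eqF.
  by move=> k; rewrite -scalemxAl -scalemxAr -!mulmxA vu mulmx1.
have [z0 [z01 z02 z03]] := point 1%:M 1%:M (mulmx1 _) (mulmx1 _).
(* M is the value at the identity, so the compact set is nonempty; a competitor outside it has value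
   above M, hence above the minimum. *)
pose M := \sum_k sqn z0 (Some k).
have K0 : (intertwined M !=set0)%classic by exists z0.
have cf : continuous (fun z => \sum_k sqn z (Some k)).
  by apply: continuous_sum => k; exact: sqn_continuous.
have [z] := compact_EVT_min K0 (@intertwined_compact M) (continuous_subspaceT cf).
rewrite inE => -[z1 z2 z3] zmin.
set G := block z None in z2.
have Gfull : row_full G.
  case: (irr G) => // [k|G0]; first by rewrite z2 submxMl.
  have := hs_block z None; rewrite -/G G0 hs0r z1 => /eqP.
  by rewrite eq_sym oner_eq0.
have Gu : G \in unitmx by rewrite -row_full_unit.
exists G, (invmx G); rewrite mulmxV ?mulVmx //; split=> // u v uv vu.
have GX k : G *m A k *m invmx G = block z (Some k).
  by rewrite z2 -mulmxA mulmxV // mulmx1.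
have [w [w1 w2 w3]] : exists w, [/\ sqn w None = 1,
     forall k, block w None *m A k = block w (Some k) *m block w None &
     forall k, block w (Some k) = u *m G *m A k *m (invmx G *m v)].
  apply: point; first by rewrite mulmxA -(mulmxA u) mulmxV // mulmx1.
  by rewrite mulmxA -(mulmxA _ v) vu mulmx1 mulVmx.
have w3' k : u *m (G *m A k *m invmx G) *m v = block w (Some k).
  by rewrite w3 !mulmxA.
under eq_bigr do rewrite GX hs_block.
under [leRHS]eq_bigr do rewrite w3' hs_block.
rewrite -!rmorph_sum lecR.
have [wM|/ltW Mw] := leP (\sum_k sqn w (Some k)) M; first by apply: zmin; rewrite inE.
exact: le_trans Mw.
Qed.

End Compactness.

(** * The first-order condition at a minimum and its consequence *)

Lemma conj_unipotent (K : comNzRingType) n (X Z : 'M[K]_n) (t : K) :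
  (1%:M + t *: Z) *m X *m (1%:M - t *: Z) =
  X + t *: (Z *m X - X *m Z) + t ^+ 2 *: (- (Z *m X *m Z)).
Proof.
rewrite mulmxDl mulmxBr !mulmxDl !mul1mx !mulmx1 -!scalemxAl -!scalemxAr.
move: (Z *m X *m Z) (Z *m X) (X *m Z) => ZXZ ZX XZ.
by apply/matrixP => i j; rewrite !mxE; ring.
Qed.

(** The Jacobi identity [[ad A, ad B] = ad [A, B]] applied to Y. With B the adjoint of A it compares
    the norms of the commutators of Y with A and with B. *)
Lemma commutator_jacobi (K : comNzRingType) n (A B Y : 'M[K]_n) :
  A *m (B *m Y - Y *m B) - (B *m Y - Y *m B) *m A -
  (B *m (A *m Y - Y *m A) - (A *m Y - Y *m A) *m B) =
  (A *m B - B *m A) *m Y - Y *m (A *m B - B *m A).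
Proof.
rewrite !mulmxBr !mulmxBl !mulmxA.
move: (A *m B *m Y) (A *m Y *m B) (B *m Y *m A) (Y *m B *m A) (B *m A *m Y)
  (B *m Y *m A) (A *m Y *m B) (Y *m A *m B) => *.
by apply/matrixP => i j; rewrite !mxE; ring.
Qed.

Section Critical.
Variable R : realType.
Local Notation C := (R[i]).

(** This replaces a derivative: at [t = - r a] with r small, the linear term [- r a ^ 2] outweighs
    the others. *)
Lemma quartic_min (a b c d : R) :
  (forall t, 0 <= t * a + t ^+ 2 * b + t ^+ 3 * c + t ^+ 4 * d) -> a = 0.
Proof.
move=> H; apply/eqP; case: (eqVneq a 0) => // nza; exfalso.
pose K := 1 + `|b| + `|c| + `|d|.
have K1 : 1 <= K.
  by rewrite /K; move: (normr_ge0 b) (normr_ge0 c) (normr_ge0 d); lra.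
have K0 : 0 < K by lra.
have a0 : 0 < `|a| by rewrite normr_gt0.
(* This r gives [r * K < 1], which makes the last factor below negative, and [|r * a| < 1], which
   keeps [|t| <= 1]. *)
pose r := (K * (1 + `|a|))^-1.
have rK : r * (K * (1 + `|a|)) = 1 by rewrite mulVf // gt_eqF // mulr_gt0 //; lra.
have r0 : 0 < r by rewrite invr_gt0 mulr_gt0 //; lra.
have rK1 : r * K < 1 by have := mulr_gt0 (mulr_gt0 r0 K0) a0; lra.
have ra1 : `|r * a| < 1.
  rewrite normrM (gtr0_norm r0).
  have : r * `|a| * 1 <= r * `|a| * K by rewrite ler_wpM2l // mulr_ge0 // ltW.
  have := mulr_gt0 r0 K0; lra.
pose t := - (r * a).
have t1 : `|t| <= 1 by rewrite normrN ltW.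
have t2 : `|t ^+ 2| <= 1 by rewrite normrX exprn_ile1.
have bnd : b + t * c + t ^+ 2 * d <= K - 1.
  have h1 : t * c <= `|c|.
    by apply: le_trans (ler_norm _) _; rewrite normrM ler_piMl.
  have h2 : t ^+ 2 * d <= `|d|.
    by apply: le_trans (ler_norm _) _; rewrite normrM ler_piMl.
  by have := ler_norm b; rewrite /K; lra.
have := H t.
have -> : t * a + t ^+ 2 * b + t ^+ 3 * c + t ^+ 4 * d =
  (r * a ^+ 2) * (r * (b + t * c + t ^+ 2 * d) - 1) by rewrite /t; ring.
have p : 0 < r * a ^+ 2 by rewrite mulr_gt0 // exprn_even_gt0.
rewrite pmulr_rge0 // => h.
have : r * (b + t * c + t ^+ 2 * d) <= r * (K - 1) by rewrite ler_wpM2l // ltW.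
lra.
Qed.

(** Basis vectors kill the off-diagonal entries, and [e_i + e_j] paired with [e_i - e_j] equates the
    diagonal ones. The pairs with [w u = 0] encode the square-zero matrices [u w] of rank at most
    one. *)
Lemma scalar_mx_pairing n (M : 'M[C]_n) :
  (forall (u : 'cV[C]_n) (w : 'rV[C]_n), w *m u = 0 -> w *m M *m u = 0) ->
  is_scalar_mx M.
Proof.
move=> H.
have off i j : i != j -> M i j = 0.
  move=> ij; have := H (delta_mx j 0) (delta_mx 0 i).
  rewrite mul_delta_mx_0 // -rowE -colE => /(_ erefl) /matrixP /(_ 0 0).
  by rewrite !mxE.
have diag i j : M i i = M j j.
  case: (eqVneq i j) => [->//|ij].
  have := H (delta_mx i 0 + delta_mx j 0) (delta_mx 0 i - delta_mx 0 j).
  rewrite mulmxDr !mulmxBl !mul_delta_mx_cond eqxx (negPf ij) eq_sym (negPf ij).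
  rewrite eqxx !mulr1n mulr0n subr0 add0r subrr => /(_ erefl) /matrixP /(_ 0 0).
  rewrite !mulmxDr -!rowE -!colE !mxE (off i j) // (off j i) 1?eq_sym //.
  rewrite addr0 add0r.
  by move/eqP; rewrite subr_eq0 => /eqP.
case: n M H off diag => [|n] M H off diag.
  by apply/is_scalar_mxP; exists 0; apply/matrixP=> -[].
apply/is_scalar_mxP; exists (M 0 0); apply/matrixP => i j; rewrite !mxE.
by case: eqVneq => [->|/off ->]; rewrite ?mulr1n ?(diag j 0) ?mulr0n.
Qed.

Lemma hs_comml m n (A : 'M[C]_m) (A' : 'M[C]_n) (Y W : 'M[C]_(m, n)) :
  hs (A *m Y - Y *m A') W = hs Y (adjmx A *m W - W *m adjmx A').
Proof. by rewrite hsDl hsNl hsMl hsMr hsBr. Qed.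

(* Only the variations 1 + t Z with Z^2 = 0 are used: their inverse 1 - t Z is
   polynomial in t, and such Z span the traceless matrices. *)
Lemma minimal_commutator n (I : Type) (r : seq I) (X : I -> 'M[C]_n) :
  (forall u v : 'M[C]_n, u *m v = 1%:M -> v *m u = 1%:M ->
    \sum_(k <- r) hs (X k) (X k) <=
    \sum_(k <- r) hs (u *m X k *m v) (u *m X k *m v)) ->
  \sum_(k <- r) (X k *m adjmx (X k) - adjmx (X k) *m X k) = 0.
Proof.
move=> Xmin; set M := \sum_(k <- r) _.
have trZM0 (Z : 'M[C]_n) : Z *m Z = 0 -> Re (\tr (Z *m M)) = 0.
  move=> ZZ.
  (* D and E are the terms of order 1 and 2 in the conjugate of X by [1 + t Z]; the growth of the
     squared norm is thus a quartic in t, with linear coefficient twice the real part of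
     [\tr (Z *m M)]. *)
  pose D k := Z *m X k - X k *m Z; pose E k := - (Z *m X k *m Z).
  have uv (t : R) : (1%:M + t%:C%C *: Z) *m (1%:M - t%:C%C *: Z) = 1%:M.
    rewrite mulmxDl !mulmxBr !mul1mx mulmx1 -scalemxAl -scalemxAr ZZ !scaler0.
    by rewrite subr0 subrK.
  have vu (t : R) : (1%:M - t%:C%C *: Z) *m (1%:M + t%:C%C *: Z) = 1%:M.
    by have := uv (- t); rewrite rmorphN !scaleNr opprK.
  have sandwich (t : R) k : (1%:M + t%:C%C *: Z) *m X k *m (1%:M - t%:C%C *: Z) =
     X k + t%:C%C *: D k + (t ^+ 2)%:C%C *: E k.
    by rewrite rmorphXn; exact: conj_unipotent.
  pose q F G := Re (\sum_(k <- r) hs (F k : 'M[C]_n) (G k)).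
  have L : q X D = Re (\tr (Z *m M)).
    congr (Re _); rewrite /M mulmx_sumr (raddf_sum (@mxtrace _ n)) /=.
    apply: eq_bigr => k _.
    rewrite /hs /D !mulmxBr !raddfB /= !mulmxA (mxtrace_mulC _ Z) !mulmxA.
    by congr (_ - _); rewrite -mulmxA mxtrace_mulC.
  have sym F G : q F G = q G F.
    rewrite /q !(raddf_sum (@complex.Re R : Rcomplex R -> R)) /=.
    by apply: eq_bigr => k _; rewrite hs_conj; case: (hs _ _).
  rewrite -L.
  suff /eqP : q X D *+ 2 = 0 by rewrite mulrn_eq0 /= => /eqP.
  apply: (@quartic_min _ (q D D + q X E *+ 2) (q D E *+ 2) (q E E)) => t.
  have := Xmin _ _ (uv t) (vu t).
  rewrite -subr_ge0 -sumrB lecE /= => /andP[_].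
  set S := \sum_(k <- r) _ => S0; suff <- : Re S = t * (q X D *+ 2) +
    t ^+ 2 * (q D D + q X E *+ 2) + t ^+ 3 * (q D E *+ 2) + t ^+ 4 * q E E by [].
  rewrite -[q X D *+ 2]/(q X D + q X D) {2}(sym X D).
  rewrite -[q X E *+ 2]/(q X E + q X E) {2}(sym X E).
  rewrite -[q D E *+ 2]/(q D E + q D E) {2}(sym D E).
  rewrite /q /S !(raddf_sum (@complex.Re R : Rcomplex R -> R)) /=.
  rewrite -!big_split /= !big_distrr /= -!big_split /=; apply: eq_bigr => k _.
  rewrite sandwich; move: (X k) (D k) (E k) => x d e.
  rewrite !hsDl !hsDr !hsZl !hsZr !conjc_real.
  move: (hs x x) (hs x d) (hs d x) (hs d d) (hs x e) (hs e x) (hs d e) (hs e d)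
    (hs e e) => -[? ?] [? ?] [? ?] [? ?] [? ?] [? ?] [? ?] [? ?] [? ?].
  by simpc => /=; ring.
(* The matrix [i Z] also squares to zero and supplies the imaginary part. *)
have trZM (Z : 'M[C]_n) : Z *m Z = 0 -> \tr (Z *m M) = 0.
  move=> ZZ; have r0 := trZM0 _ ZZ.
  have := trZM0 ('i%C *: Z); rewrite -scalemxAl -scalemxAr ZZ !scaler0.
  move=> /(_ erefl); rewrite -scalemxAl mxtraceZ mulrC ReiNIm => /eqP.
  rewrite oppr_eq0 => /eqP i0.
  by rewrite [LHS]complexE r0 i0 mulr0 addr0.
(* M is a sum of commutators, hence traceless; once known to be scalar, it vanishes. *)
have trM : \tr M = 0.
  rewrite /M (raddf_sum (@mxtrace _ n)) big1 // => k _.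
  by rewrite raddfB /= mxtrace_mulC subrr.
have /is_scalar_mxP[c Mc] : is_scalar_mx M.
  apply: scalar_mx_pairing => u w wu; apply/matrixP => i j.
  rewrite !ord1 [RHS]mxE; have := trZM (u *m w).
  rewrite mulmxA -(mulmxA u) wu mulmx0 mul0mx => /(_ erefl).
  by rewrite -mulmxA mxtrace_mulC /mxtrace big_ord1.
move: trM; rewrite Mc mxtrace_scalar => /eqP; rewrite mulrn_eq0.
case/orP=> [/eqP n0|/eqP->]; last by rewrite raddf0.
by clear -n0; move: c; rewrite {n}n0 => c; apply/matrixP=> -[].
Qed.

Variables (g : vectType R) (br : g -> g -> g).
Hypothesis lie : is_lie_bracket br.

Section Rep.
Variables (n : nat) (X : g -> 'M[C]_n).
Hypothesis repX : is_rep br X.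

Lemma repD x y : X (x + y) = X x + X y. Proof. by case: repX. Qed.
Lemma repZ a x : X (a *: x) = a%:C%C *: X x. Proof. by case: repX. Qed.
Lemma repP a x y : X (a *: x + y) = a%:C%C *: X x + X y.
Proof. by rewrite repD repZ. Qed.
Lemma rep0 : X 0 = 0.
Proof. by have := repZ 0 0; rewrite !scale0r. Qed.
Lemma repbr x y : X (br x y) = X x *m X y - X y *m X x.
Proof. by case: repX. Qed.
End Rep.

Lemma adjmx_rep n (X : g -> 'M[C]_n) a x y : is_rep br X ->
  adjmx (X (a *: x + y)) = a%:C%C *: adjmx (X x) + adjmx (X y).
Proof. by move=> rX; rewrite (repP rX) adjmxD adjmxZ conjc_real. Qed.

Lemma frame_ind (B : g -> g -> R) (s : seq g) (P : g -> Prop) :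
  (forall x, x \in {:g}%VS -> x = \sum_(e <- s) B x e *: e) ->
  P 0 -> (forall a x y, P x -> P y -> P (a *: x + y)) ->
  (forall e, e \in s -> P e) -> forall x, P x.
Proof.
move=> sE P0 PZ Ps x; rewrite (sE x (memvf x)) big_seq.
elim/big_ind: _ => // [u v Pu Pv|e es]; first by rewrite -[u]scale1r; exact: PZ.
by rewrite -[_ *: e]addr0; apply: PZ => //; exact: Ps.
Qed.

(* With L_e = [X_e, _], criticality gives sum |L_e^* X_f|^2 = sum |L_e X_f|^2, and
   antisymmetry of the structure constants then gives L_e^* X_f = - L_e X_f. *)
Lemma critical_skew (B : g -> g -> R) (s : seq g) n (X : g -> 'M[C]_n) :
  semisimple br -> inner_product B ->
  (forall x y z, B (br x y) z + B y (br x z) = 0) ->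
  (forall x, x \in {:g}%VS -> x = \sum_(e <- s) B x e *: e) ->
  is_rep br X ->
  \sum_(e <- s) (X e *m adjmx (X e) - adjmx (X e) *m X e) = 0 ->
  forall x, adjmx (X x) = - X x.
Proof.
move=> ss ipB B4 sE rX crit.
have cs : compact_semisimple br.
  by split=> //; exists B; case: ipB => ? ? ?; split.
pose Ld e Y := adjmx (X e) *m Y - Y *m adjmx (X e).
pose L e Y := X e *m Y - Y *m X e.
have LX e f : L e (X f) = X (br e f) by rewrite (repbr rX).
(* By the Jacobi identity the two sides differ by the pairing of Y with the commutator of the
   critical sum and Y, which is zero. *)
have norm_Ld Y : \sum_(e <- s) hs (Ld e Y) (Ld e Y) =
                 \sum_(e <- s) hs (L e Y) (L e Y).
  apply/eqP; rewrite -subr_eq0 -sumrB; apply/eqP.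
  transitivity (hs Y ((\sum_(e <- s) (X e *m adjmx (X e) - adjmx (X e) *m X e)) *m Y
     - Y *m (\sum_(e <- s) (X e *m adjmx (X e) - adjmx (X e) *m X e)))).
    rewrite mulmx_suml mulmx_sumr -sumrB hs_sumr; apply: eq_bigr => e _.
    rewrite !hs_comml adjmxK -hsBr; congr (hs _ _).
    exact: commutator_jacobi.
  by rewrite crit mul0mx mulmx0 subrr hs0r.
(* Move the adjoint to the other slot, then use that [br e] is skew for B. *)
have cross e : \sum_(f <- s) hs (Ld e (X f)) (X (br e f)) =
             - \sum_(f <- s) hs (X (br e f)) (X (br e f)).
  have := @skew_frame_sum R g B ipB C^o fullv s (br e)
    (fun x y => hs (X x) (X (br e y))) (fun x _ => memvf x) sE (fun x _ => memvf _).
  move=> H; rewrite -H.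
  - apply: eq_bigr => f _; rewrite hs_comml adjmxK -/(L e _) LX //.
  - move=> x y _ _; apply/eqP; rewrite -addr_eq0; apply/eqP; exact: B4.
  - move=> a x y z; rewrite (repP rX) hsDl hsZl conjc_real //.
  - move=> a x y z; case: lie => _ -> _ _; rewrite (repP rX) hsDr hsZr //.
have cross' e : \sum_(f <- s) hs (X (br e f)) (Ld e (X f)) =
             - \sum_(f <- s) hs (X (br e f)) (X (br e f)).
  rewrite -[RHS]conjcK rmorphN rmorph_sum /=.
  under [in RHS]eq_bigr do rewrite -hs_conj.
  rewrite -cross rmorph_sum; apply: eq_bigr => f _; exact: hs_conj.
(* Summed over e and f, the squared norms of these matrices expand to zero: the cross terms absorb
   one square, and [norm_Ld] cancels the rest. Hence each of them vanishes. *)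
have key0 e f : e \in s -> f \in s -> Ld e (X f) + X (br e f) = 0.
  move=> es fs; apply: hs_eq0.
  have expand (a b : 'M[C]_n) :
      hs (a + b) (a + b) = hs a a + hs a b + (hs b a + hs b b).
    by rewrite hsDl !hsDr.
  have h e' f' : 0 <= hs (Ld e' (X f') + X (br e' f')) (Ld e' (X f') + X (br e' f')).
    exact: hs_ge0.
  have h' e' : 0 <= \sum_(f <- s)
      hs (Ld e' (X f) + X (br e' f)) (Ld e' (X f) + X (br e' f)).
    exact: sumr_ge0.
  apply: (psum_eq0 (h e) _ fs); apply: (psum_eq0 h' _ es).
  under eq_bigr => e' _.
    under eq_bigr do rewrite expand.
    rewrite !big_split /= cross cross'; over.
  rewrite !big_split /= sumrN addrA subrK.
  rewrite exchange_big /=; under eq_bigr do rewrite norm_Ld.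
  rewrite exchange_big /=; apply/eqP; rewrite addrC -subr_eq0; apply/eqP.
  rewrite subr0 addrC; apply/eqP; rewrite subr_eq0; apply/eqP.
  by apply: eq_bigr => e' _; apply: eq_bigr => f' _; rewrite LX.
have key x y : Ld x (X y) + X (br x y) = 0.
  have Ld0 Y : Ld 0 Y = 0 by rewrite /Ld (rep0 rX) adjmx0 mul0mx mulmx0 subrr.
  move: x; apply: (frame_ind sE).
  - by rewrite Ld0 (lie0l lie) (rep0 rX) addr0.
  - move=> a u v hu hv; transitivity
      (a%:C%C *: (Ld u (X y) + X (br u y)) + (Ld v (X y) + X (br v y))).
      case: lie => -> _ _ _; rewrite /Ld (adjmx_rep _ _ _ rX) (repP rX).
      rewrite mulmxDl mulmxDr -scalemxAl -scalemxAr.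
      by apply/matrixP => i j; rewrite !mxE; ring.
    by rewrite hu hv scaler0 addr0.
  move=> e es; move: y; apply: (frame_ind sE).
  - by rewrite (lie0r lie) (rep0 rX) addr0 /Ld mulmx0 mul0mx subrr.
  - move=> a u v hu hv; transitivity
      (a%:C%C *: (Ld e (X u) + X (br e u)) + (Ld e (X v) + X (br e v))).
      case: lie => _ -> _ _; rewrite /Ld !(repP rX).
      rewrite mulmxDl mulmxDr -scalemxAl -scalemxAr.
      by apply/matrixP => i j; rewrite !mxE; ring.
    by rewrite hu hv scaler0 addr0.
  by move=> f fs; exact: key0.
apply: (perfect_ind lie cs).
- by rewrite (rep0 rX) adjmx0 oppr0.
- move=> a x y hx hy; rewrite (adjmx_rep _ _ _ rX) hx hy (repP rX).
  by rewrite opprD scalerN.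
(* On a bracket, compare the adjoint of [key x y] with [key y x]. *)
move=> x y; rewrite (repbr rX) adjmxB !adjmxM.
have h1 := congr1 (@adjmx R n n) (key x y).
have h2 := key y x.
rewrite /Ld (repbr rX) adjmx0 !adjmxD adjmxN !adjmxM adjmxK in h1.
rewrite /Ld (repbr rX) in h2.
rewrite adjmxN !adjmxM in h1.
by have /addrI -> := etrans h1 (esym h2); rewrite opprB.
Qed.

End Critical.

(** * Cocycles and unitarizability of all representations *)

Section Fitting.
Variables (K : fieldType) (V : vectType K) (f : V -> V).

(** The hypothesis makes image and kernel meet trivially, and by rank-nullity they then span V. *)
Lemma fitting_split : linear f -> (forall u, f (f u) = 0 -> f u = 0) ->
  forall v, exists w z, v = f w + z /\ f z = 0.
Proof.
move=> flin ff v.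
pose F : {linear V -> V} := HB.pack f (GRing.isLinear.Build K V V _ f flin).
pose L := linfun F.
have LE u : L u = f u by rewrite lfunE.
have cap0 : (limg L :&: lker L = 0)%VS.
  apply/eqP; rewrite -subv0; apply/subvP => y; rewrite memv_cap => /andP[].
  case/memv_imgP => u _ ->; rewrite memv_ker !LE => /eqP /ff ->.
  exact: mem0v.
have full : (limg L + lker L)%VS = fullv.
  apply/eqP; rewrite eqEdim subvf /= dimv_disjoint_sum //.
  by have := limg_ker_dim L fullv; rewrite capfv addnC => ->.
have : v \in (limg L + lker L)%VS by rewrite full memvf.
case/memv_addP => _ /memv_imgP[w _ ->] [z zk ->].
by exists w, z; rewrite LE; split=> //; apply/eqP; rewrite -LE -memv_ker.
Qed.

End Fitting.

Section Unitarizable.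
Variables (R : realType) (g : vectType R) (br : g -> g -> g).
Local Notation C := (R[i]).

(** The size m is left free, although the inverses force it to equal n, so that passing to block
    form p + q needs no cast. *)
Definition unitarizable n (X : g -> 'M[C]_n) : Prop :=
  exists m (P : 'M[C]_(m, n)) (Q : 'M[C]_(n, m)),
    [/\ P *m Q = 1%:M, Q *m P = 1%:M &
      forall x, adjmx (P *m X x *m Q) = - (P *m X x *m Q)].

Lemma unitarizable_conj m n (P : 'M[C]_(m, n)) (Q : 'M[C]_(n, m)) X :
  P *m Q = 1%:M -> Q *m P = 1%:M ->
  unitarizable (fun x => P *m X x *m Q) -> unitarizable X.
Proof.
move=> PQ QP [k [P' [Q' [PQ' QP' H]]]].
exists k, (P' *m P), (Q *m Q'); split.
- by rewrite mulmxA -(mulmxA P') PQ mulmx1.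
- by rewrite mulmxA -(mulmxA Q) QP' mulmx1.
by move=> x; have := H x; rewrite !mulmxA.
Qed.

Lemma rep_conj m n (P : 'M[C]_(m, n)) (Q : 'M[C]_(n, m)) X :
  Q *m P = 1%:M -> is_rep br X -> is_rep br (fun x => P *m X x *m Q).
Proof.
move=> QP [XD XZ Xb]; split=> [x y|a x|x y].
- by rewrite XD mulmxDr mulmxDl.
- by rewrite XZ -scalemxAr -scalemxAl.
rewrite Xb mulmxBr mulmxBl.
have E u v : P *m X u *m Q *m (P *m X v *m Q) = P *m (X u *m X v) *m Q.
  by rewrite !mulmxA -(mulmxA _ Q P) QP mulmx1.
by rewrite !E.
Qed.

Hypothesis lie : is_lie_bracket br.
Hypothesis ss : semisimple br.
Variable B : g -> g -> R.
Hypothesis ipB : inner_product B.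
Hypothesis B4 : forall x y z, B (br x y) z + B y (br x z) = 0.

Lemma irreducible_unitarizable n (X : g -> 'M[C]_n) : (0 < n)%N ->
  is_rep br X ->
  (forall U : 'M[C]_n, (forall x, (U *m X x <= U)%MS) -> U = 0 \/ row_full U) ->
  unitarizable X.
Proof.
move=> n_gt0 rX irr.
have [s [_ sE]] := ip_frame ipB fullv.
pose A (k : 'I_(size s)) := X (nth 0 s k).
have [|P [Q [PQ QP PQmin]]] := @conjugate_min R n _ A n_gt0.
  move=> U stU; apply: irr; apply: (frame_ind sE).
  - by rewrite (rep0 rX) mulmx0 sub0mx.
  - move=> a x y hx hy; rewrite (repP rX) mulmxDr -scalemxAr.
    by rewrite addmx_sub // scalemx_sub.
  move=> e es; have ek : (index e s < size s)%N by rewrite index_mem.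
  by have := stU (Ordinal ek); rewrite /A /= nth_index.
exists n, P, Q; split=> //.
apply: (critical_skew lie ss ipB B4 sE (rep_conj QP rX)).
by rewrite (big_nth 0) big_mkord; apply: minimal_commutator.
Qed.

(* Subtracting from b the coboundary given by the normal equations leaves a
   cocycle c with sum_e T_e (c e) = 0, whence sum_e T_e (T_e (c y)) = 0. *)
Lemma cocycle_coboundary p q (a : g -> 'M[C]_q) (d : g -> 'M[C]_p)
    (b : g -> 'M[C]_(p, q)) :
  is_rep br a -> is_rep br d ->
  (forall x, adjmx (a x) = - a x) -> (forall x, adjmx (d x) = - d x) ->
  (forall t x y, b (t *: x + y) = t%:C%C *: b x + b y) ->
  (forall x y, b (br x y) =
     (b x *m a y + d x *m b y) - (b y *m a x + d y *m b x)) ->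
  exists w, forall x, b x = d x *m w - w *m a x.
Proof.
move=> ra rd askew dskew blin bco.
have [s [_ sE]] := ip_frame ipB fullv.
pose T x (w : 'M[C]_(p, q)) := d x *m w - w *m a x.
have Tlin x : linear (T x).
  move=> t u v; rewrite /T mulmxDr mulmxDl -scalemxAr -scalemxAl.
  rewrite scalerBr opprD !addrA; congr (_ - _).
  by rewrite -!addrA; congr (_ + _); rewrite addrC.
have TlinL t x y w : T (t *: x + y) w = t%:C%C *: T x w + T y w.
  rewrite /T (repP ra) (repP rd) mulmxDr mulmxDl -scalemxAr -scalemxAl.
  rewrite scalerBr opprD !addrA; congr (_ - _).
  by rewrite -!addrA; congr (_ + _); rewrite addrC.
have T0 x : T x 0 = 0 by rewrite /T mulmx0 mul0mx subrr.
have T0l w : T 0 w = 0 by rewrite /T (rep0 ra) (rep0 rd) mulmx0 mul0mx subrr.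
have TD x u v : T x (u + v) = T x u + T x v by have := Tlin x 1 u v; rewrite !scale1r.
have TN x u : T x (- u) = - T x u by have := Tlin x (-1) u 0; rewrite !scaleN1r T0 !addr0.
have Tskew x u v : hs (T x u) v = - hs u (T x v).
  rewrite hs_comml askew dskew -hsNr; congr (hs _ _).
  by rewrite mulNmx mulmxN opprB opprK addrC.
have Tbr x y w : T (br x y) w = T x (T y w) - T y (T x w).
  rewrite /T (repbr ra) (repbr rd) !mulmxBr !mulmxBl !mulmxA.
  by apply/matrixP => i j; rewrite !mxE; ring.
have bcoT x y : b (br x y) = T x (b y) - T y (b x).
  by rewrite bco /T; apply/matrixP => i j; rewrite !mxE; ring.
have TE x u : d x *m u - u *m a x = T x u by [].
clearbody T.
(* K is self-adjoint and negative semidefinite, so its kernel is the common kernel of the [T e], and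
   it satisfies the hypothesis of [fitting_split]. *)
pose K w := \sum_(e <- s) T e (T e w).
have Klin : linear K.
  move=> t u v; rewrite /K scaler_sumr -big_split /=; apply: eq_bigr => e _.
  by rewrite !Tlin.
have hsK u : hs u (K u) = - \sum_(e <- s) hs (T e u) (T e u).
  rewrite /K hs_sumr -sumrN; apply: eq_bigr => e _.
  by rewrite Tskew opprK.
have K0 u : K u = 0 -> forall e, e \in s -> T e u = 0.
  move=> Ku e es; apply: hs_eq0.
  apply: (psum_eq0 (fun e => hs_ge0 (T e u)) _ es); apply/eqP.
  by rewrite -oppr_eq0 -hsK Ku hs0r.
have KK u : K (K u) = 0 -> K u = 0.
  move=> /K0 H; apply: hs_eq0; rewrite {2}/K hs_sumr big_seq big1 // => e es.
  have := Tskew e (K u) (T e u); rewrite H // hs0l => /eqP.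
  by rewrite eq_sym oppr_eq0 => /eqP.
have [w [z [vE Kz]]] := fitting_split Klin KK (\sum_(e <- s) T e (b e)).
exists w.
pose c x := b x - T x w.
have clin t x y : c (t *: x + y) = t%:C%C *: c x + c y.
  rewrite /c blin TlinL scalerBr opprD !addrA; congr (_ - _).
  by rewrite -!addrA; congr (_ + _); rewrite addrC.
have zE : z = \sum_(e <- s) T e (c e).
  have -> : z = \sum_(e <- s) T e (b e) - K w by rewrite vE addrC addKr.
  by rewrite /K -sumrB; apply: eq_bigr => e _; rewrite /c TD TN.
(* z is killed by every [T e] and is also a sum of their values; skewness makes it orthogonal to
   itself. *)
have z0 : z = 0.
  apply: hs_eq0; rewrite {2}zE hs_sumr big_seq big1 // => e es.
  have := Tskew e z (c e); rewrite (K0 _ Kz) // hs0l => /eqP.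
  by rewrite eq_sym oppr_eq0 => /eqP.
have cbr x y : c (br x y) = T x (c y) - T y (c x).
  by rewrite /c bcoT Tbr !TD !TN; apply/matrixP => i j; rewrite !mxE; ring.
have cE x : c x = b x - T x w by [].
clearbody c.
(* The cocycle identity moves y outwards: [T y z] vanishes, and the two remaining sums cancel
   because bracketing with y is skew for B. *)
have Kc y : K (c y) = 0.
  have := @skew_frame_sum R g B ipB _ fullv s (fun x => br x y)
    (fun u v => T u (c v)) (fun x _ => memvf x) sE (fun x _ => memvf _).
  move=> H; transitivity (\sum_(e <- s) T e (c (br e y)) +
      \sum_(e <- s) T (br e y) (c e) + T y z).
    rewrite zE.
    have -> : T y (\sum_(e <- s) T e (c e)) = \sum_(e <- s) T y (T e (c e)).
      by apply: (big_morph _ (TD y) (T0 y)).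
    rewrite /K -!big_split /=; apply: eq_bigr => e _.
    rewrite cbr Tbr TD TN.
    by apply/matrixP => i j; rewrite !mxE; ring.
  rewrite z0 T0 addr0 H ?addNr //.
  - move=> x u _ _; have /eqP := B4 y x u; rewrite addr_eq0 => /eqP.
    by rewrite (lieC lie y x) (lieC lie y u) (ipNl ipB) (ipNr ipB) => /oppr_inj.
  move=> t x u v; rewrite clin Tlin //.
have Tc x y : T x (c y) = 0.
  move: x; apply: (frame_ind sE) => [|t u v hu hv|e es]; first exact: T0l.
    by rewrite TlinL hu hv scaler0 addr0.
  exact: K0.
have c0 : forall x, c x = 0.
  apply: (perfect_ind lie).
  - by split=> //; exists B; case: ipB => ? ? ?; split.
  - by have := (clin (-1) 0 0); rewrite scaler0 addr0 rmorphN1 scaleN1r addNr.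
  - by move=> t x y hx hy; rewrite clin hx hy scaler0 addr0.
  by move=> x y; rewrite cbr !Tc subrr.
by move=> x; apply/eqP; rewrite -subr_eq0 TE -cE c0.
Qed.

Lemma block_rep p q (Y : g -> 'M[C]_(p + q)) a b d :
  is_rep br Y -> (forall x, Y x = block_mx (a x) 0 (b x) (d x)) ->
  [/\ is_rep br a, is_rep br d,
      (forall t x y, b (t *: x + y) = t%:C%C *: b x + b y) &
      (forall x y, b (br x y) =
         (b x *m a y + d x *m b y) - (b y *m a x + d y *m b x))].
Proof.
move=> [YD YZ Yb] YE.
have hD x y : [/\ a (x + y) = a x + a y, b (x + y) = b x + b y & d (x + y) = d x + d y].
  by have := YD x y; rewrite !YE add_block_mx => /eq_block_mx[].
have hZ t x : [/\ a (t *: x) = t%:C%C *: a x, b (t *: x) = t%:C%C *: b x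
    & d (t *: x) = t%:C%C *: d x].
  by have := YZ t x; rewrite !YE scale_block_mx => /eq_block_mx[].
have hb x y : [/\ a (br x y) = a x *m a y - a y *m a x,
    b (br x y) = (b x *m a y + d x *m b y) - (b y *m a x + d y *m b x) &
    d (br x y) = d x *m d y - d y *m d x].
  have := Yb x y; rewrite !YE !mulmx_block opp_block_mx add_block_mx.
  rewrite !mul0mx !mulmx0 !addr0 !add0r => /eq_block_mx[-> _ -> ->].
  by split.
split.
- by split=> [x y|t x|x y]; [case: (hD x y)|case: (hZ t x)|case: (hb x y)].
- by split=> [x y|t x|x y]; [case: (hD x y)|case: (hZ t x)|case: (hb x y)].
- by move=> t x y; have [_ -> _] := hD (t *: x) y; have [_ -> _] := hZ t x.
- by move=> x y; case: (hb x y).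
Qed.

(** Once the diagonal blocks are skew-Hermitian, the off-diagonal block is a coboundary of some w,
    and conjugating by the unipotent matrix with entry w removes it. *)
Lemma block_unitarizable p q (Y : g -> 'M[C]_(p + q)) a b d :
  is_rep br Y -> (forall x, Y x = block_mx (a x) 0 (b x) (d x)) ->
  unitarizable a -> unitarizable d -> unitarizable Y.
Proof.
move=> rY YE [p' [P1 [Q1 [PQ1 QP1 H1]]]] [q' [P2 [Q2 [PQ2 QP2 H2]]]].
pose P := block_mx P1 0 0 P2; pose Q := block_mx Q1 0 0 Q2.
have QP : Q *m P = 1%:M.
  by rewrite mulmx_block !mul0mx !mulmx0 !addr0 !add0r QP1 QP2 -scalar_mx_block.
have PQ : P *m Q = 1%:M.
  by rewrite mulmx_block !mul0mx !mulmx0 !addr0 !add0r PQ1 PQ2 -scalar_mx_block.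
apply: (unitarizable_conj PQ QP).
have rY' := rep_conj QP rY.
have Y'E x : P *m Y x *m Q =
    block_mx (P1 *m a x *m Q1) 0 (P2 *m b x *m Q1) (P2 *m d x *m Q2).
  by rewrite YE !mulmx_block !mul0mx !mulmx0 !addr0 !mul0mx !add0r ?addr0.
have [ra rd blin bco] := block_rep rY' Y'E.
have [w /= wE] := cocycle_coboundary ra rd H1 H2 blin bco.
pose S : 'M[C]_(p' + q') := block_mx 1%:M 0 w 1%:M.
pose S' : 'M[C]_(p' + q') := block_mx 1%:M 0 (- w) 1%:M.
have SS' : S *m S' = 1%:M.
  by rewrite mulmx_block !mul0mx !mulmx0 !addr0 !mul1mx mulmx1 subrr add0r -scalar_mx_block.
have S'S : S' *m S = 1%:M.
  by rewrite mulmx_block !mul0mx !mulmx0 !addr0 !mul1mx mulmx1 addNr add0r -scalar_mx_block.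
apply: (unitarizable_conj SS' S'S).
exists (p' + q')%N, 1%:M, 1%:M; split; rewrite ?mulmx1 // => x.
rewrite mul1mx mulmx1 Y'E.
have -> : S *m block_mx (P1 *m a x *m Q1) 0 (P2 *m b x *m Q1) (P2 *m d x *m Q2) *m S' =
    block_mx (P1 *m a x *m Q1) 0 0 (P2 *m d x *m Q2).
  rewrite !mulmx_block !mul0mx !mulmx0 !addr0 !mul1mx !mulmx1 !add0r.
  congr block_mx; first by rewrite mul0mx addr0.
  by rewrite wE mulmxN; apply/matrixP => i j; rewrite !mxE; ring.
by rewrite adjmx_block H1 H2 !adjmx0 opp_block_mx !oppr0.
Qed.

Lemma rep_unitarizable n (X : g -> 'M[C]_n) : is_rep br X -> unitarizable X.
Proof.
have [N] := ubnP n; elim: N n X => // N IH n X nN rX.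
have [n0|n_gt0] := posnP n.
  move: X rX {nN}; rewrite n0 => X _.
  by exists 0%N, 0, 0; split=> [||x]; apply/matrixP => -[].
have [irr|] := pselect (forall U : 'M[C]_n,
    (forall x, (U *m X x <= U)%MS) -> U = 0 \/ row_full U).
  exact: irreducible_unitarizable.
move=> /existsNP[U /not_implyP[stU /not_orP[nzU nfU]]].
have rk0 : (0 < \rank U)%N by rewrite lt0n mxrank_eq0; apply/eqP.
have rkn : (\rank U < n)%N.
  by rewrite ltn_neqAle rank_leq_row andbT; apply/negP.
have rkC : \rank (U^C)%MS = (n - \rank U)%N by rewrite mxrank_compl.
(* A basis of U stacked on a basis of a complement: in these coordinates X is block lower
   triangular. *)
pose T := col_mx (row_base U) (row_base (U^C)%MS).
have TU : (T :=: 1%:M)%MS.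
  apply/eqmxP; rewrite submx1 /= sub1mx -sub1mx.
  apply: submx_trans (_ : U + U^C <= _)%MS; first by rewrite sub1mx addsmx_compl_full.
  by rewrite -addsmxE; apply: addsmxS; rewrite eq_row_base.
have Trank : \rank T = n by rewrite TU mxrank1.
have Tfull : row_full T by rewrite /row_full Trank.
have Tfree : row_free T by rewrite /row_free Trank rkC subnKC // ltnW.
have TT' := mulmxVp Tfree; have T'T := mulVpmx Tfull.
set T' := pinvmx T in TT' T'T.
apply: (unitarizable_conj TT' T'T).
have rY := rep_conj T'T rX.
set Y := (fun x => _) in rY *.
have Yur x : ursubmx (Y x) = 0.
  have /submxP[c cE] : (row_base U *m X x <= row_base U)%MS.
    by rewrite (eqmxMr _ (eq_row_base U)) eq_row_base.
  have E : row_base U *m T' = row_mx 1%:M 0.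
    by rewrite -[RHS]mulmx1 -TT' mulmxA mul_row_col mul1mx mul0mx addr0.
  rewrite /Y mul_col_mx cE mul_col_mx -(mulmxA c) E mul_mx_row mulmx1 mulmx0.
  by rewrite /ursubmx col_mxKu row_mxKr.
have YE x : Y x = block_mx (ulsubmx (Y x)) 0 (dlsubmx (Y x)) (drsubmx (Y x)).
  by rewrite -[LHS]submxK Yur.
have [ra rd _ _] := block_rep rY YE.
apply: (block_unitarizable rY YE).
  by apply: (IH _ _ _ ra); exact: leq_trans rkn nN.
by apply: (IH _ _ _ rd); rewrite rkC; move: rk0 rkn nN; clear; lia.
Qed.

End Unitarizable.

(** * Complete reducibility, Schur's lemma and the two norms *)

Section DimSet.
Variables (K : fieldType) (vT : vectType K).

Lemma dim_setE (A : set vT) (s : seq vT) : free s ->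
  (forall v, v \in s -> A v) -> (forall v, A v -> v \in <<s>>%VS) ->
  dim_set A = size s.
Proof.
move=> fs sA As; apply/eqP; rewrite eqn_leq; apply/andP; split.
  apply/bigmax_leqP => k /asboolP[t [<- ft tA]].
  rewrite -(eqP fs : \dim <<s>> = size s)%N -(eqP ft : \dim <<t>> = size t)%N.
  by apply: dimvS; apply/span_subvP => v /tA /As.
have ks : (size s < (\dim {: vT}).+1)%N.
  by rewrite ltnS -(eqP fs : \dim <<s>> = size s)%N dimvS // subvf.
apply: (leq_bigmax_cond (Ordinal ks)).
by apply/asboolP; exists s.
Qed.

Lemma dim_set_vspace (A : set vT) (U : {vspace vT}) :
  (forall v, v \in U <-> A v) -> dim_set A = \dim U.
Proof.
move=> UA; rewrite (@dim_setE A (vbasis U)) ?size_tuple //.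
- exact: basis_free (vbasisP U).
- by move=> v /vbasis_mem /UA.
- by move=> v /UA; rewrite (span_basis (vbasisP U)).
Qed.

Lemma free_map (I : eqType) (r : seq I) (E : I -> vT) : uniq r ->
  (forall k : I -> K, \sum_(i <- r) k i *: E i = 0 ->
     forall i, i \in r -> k i = 0) ->
  free [seq E i | i <- r].
Proof.
have spanE (s : seq I) : uniq s -> forall v, v \in <<[seq E i | i <- s]>>%VS ->
    exists k : I -> K, v = \sum_(i <- s) k i *: E i.
  elim: s => [|i s IHs] /=.
    by move=> _ v; rewrite span_nil memv0 => /eqP->; exists (fun=> 0); rewrite big_nil.
  move=> /andP[iNs us] v; rewrite span_cons => /memv_addP[_ /vlineP[c ->]].
  case=> w /(IHs us)[k ->] ->.
  exists (fun j => if j == i then c else k j); rewrite big_cons eqxx; congr (_ + _).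
  by apply: eq_big_seq => j js; case: eqP => // ji; rewrite -ji js in iNs.
elim: r => [|i r IHr] /=; first by move=> _ _; exact: nil_free.
move=> /andP[iNr ur] H; rewrite free_cons; apply/andP; split.
  apply/negP => /(spanE _ ur)[k kE].
  have sE c : \sum_(j <- r) (if j == i then c else k j) *: E j =
              \sum_(j <- r) k j *: E j.
    by apply: eq_big_seq => j jr /=; case: (j =P i) => // ji; rewrite -ji jr in iNr.
  have := H (fun j => if j == i then -1 else k j).
  rewrite big_cons eqxx scaleN1r sE -kE addNr => /(_ erefl i).
  rewrite mem_head eqxx => /(_ isT) /eqP.
  by rewrite oppr_eq0 oner_eq0.
apply: IHr => // k Hk j jr.
have sE : \sum_(l <- r) (if l == i then 0 else k l) *: E l =
          \sum_(l <- r) k l *: E l.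
  by apply: eq_big_seq => l lr /=; case: (l =P i) => // li; rewrite -li lr in iNr.
have := H (fun l => if l == i then 0 else k l).
rewrite big_cons eqxx scale0r add0r sE => /(_ Hk j).
rewrite inE jr orbT => /(_ erefl).
by case: (j =P i) => // ji; rewrite -ji jr in iNr.
Qed.

End DimSet.

Section MatrixAction.
Variables (K : fieldType) (N : nat).

Definition mxker M (A : 'M[K]_(M, N)) : {vspace 'cV[K]_N} :=
  lker (linfun (mulmx A : 'cV[K]_N -> 'cV[K]_M)).

Lemma mem_mxker M (A : 'M[K]_(M, N)) v : (v \in mxker A) = (A *m v == 0).
Proof. by rewrite memv_ker lfunE. Qed.

Lemma mx_of_lfun (f : 'End('cV[K]_N)) : exists A : 'M[K]_N, forall v, A *m v = f v.
Proof.
exists (\matrix_(i, j) f (delta_mx j 0) i 0) => v.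
have -> : v = \sum_j v j 0 *: delta_mx j 0.
  rewrite {1}[v]matrix_sum_delta; apply: eq_bigr => j _.
  by rewrite big_ord1.
rewrite mulmx_sumr linear_sum; apply: eq_bigr => j _.
rewrite -scalemxAr linearZ; congr (_ *: _); rewrite -colE.
by apply/matrixP => i l; rewrite !mxE ord1.
Qed.

(** Injectivity and equal dimensions make T a bijection from U onto V. Composing with the projection
    onto U lets a pseudo-inverse on the whole space serve as its inverse. *)
Lemma inverse_on (U V : {vspace 'cV[K]_N}) (T : 'M[K]_N) :
  (forall v, v \in U -> T *m v \in V) ->
  (forall v, v \in U -> T *m v = 0 -> v = 0) -> \dim U = \dim V ->
  exists T' : 'M[K]_N, (forall v, v \in V -> T' *m v \in U /\ T *m (T' *m v) = v).
Proof.
move=> TUV Tinj dUV.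
pose f := linfun (mulmx T : 'cV[K]_N -> 'cV[K]_N).
have fE v : f v = T *m v by rewrite lfunE.
have kerU : (U :&: lker f = 0)%VS.
  apply/eqP; rewrite -subv0; apply/subvP => v; rewrite memv_cap memv_ker fE.
  by move=> /andP[vU /eqP /(Tinj _ vU) ->]; rewrite mem0v.
have fU : (f @: U = V)%VS.
  apply/eqP; rewrite eqEdim -dUV (limg_dim_eq kerU) leqnn andbT.
  by apply/subvP => _ /memv_imgP[u uU ->]; rewrite fE TUV.
pose fp := (f \o projv U)%VF.
have fpV : limg fp = V by rewrite limg_comp limg_proj fU.
have [T' T'E] := mx_of_lfun (projv U \o fp^-1)%VF.
exists T' => v vV; rewrite T'E comp_lfunE memv_proj; split=> //.
have : fp (fp^-1%VF v) = v by apply: limg_lfunVK; rewrite fpV.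
by rewrite comp_lfunE /= fE.
Qed.

End MatrixAction.

(** * Schur's lemma *)

Section Schur.
Variables (R : realType) (g : vectType R).
Local Notation C := (R[i]).
Variables (N : nat) (psi : g -> 'M[C]_N) (S : {vspace g}).
Local Notation irr := (irreducible_sub psi S).
Local Notation equiv := (equiv_sub psi S).

(** By Cayley-Hamilton the product of the factors [X - z] over the roots kills v. The last nonzero
    partial product applied to v is an eigenvector, and it lies in U as a polynomial in X applied to
    v. *)
Lemma eigenvector_in (U : {vspace 'cV[C]_N}) (X : 'M[C]_N) : U != 0%VS ->
  (forall v, v \in U -> X *m v \in U) ->
  exists c v, [/\ v \in U, v != 0 & X *m v = c *: v].
Proof.
move=> nzU XU; have vU := memv_pick U; have := vpick0 U; rewrite (negPf nzU).
move: (vpick U) vU => v vU /negbT nzv {nzU}.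
case: N X U XU v vU nzv => [|n] X U XU v vU nzv.
  by move: nzv; rewrite (_ : v = 0) ?eqxx //; apply/matrixP => -[].
have [rs rsE] := closed_field_poly_normal (char_poly X).
have := Cayley_Hamilton X; rewrite rsE linearZ /= (monicP (char_poly_monic X)) scale1r.
rewrite rmorph_prod /= => H.
have {H} : (\prod_(z <- rs) horner_mx X ('X - z%:P)) *m v = 0 by rewrite H mul0mx.
elim: rs {rsE} => [|z rs IHrs].
  by rewrite big_nil mul1mx => v0; rewrite v0 eqxx in nzv.
rewrite big_cons -[_ * _]/(_ *m _) -mulmxA rmorphB /= horner_mx_X horner_mx_C.
set w := _ *m v; have [/IHrs //|nzw] := eqVneq w 0.
rewrite mulmxBl mul_scalar_mx => /eqP; rewrite subr_eq0 => /eqP Xw.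
exists z, w; split=> //; rewrite /w; elim: (rs) => [|y ys IHy].
  by rewrite big_nil mul1mx.
rewrite big_cons -[_ * _]/(_ *m _) -mulmxA rmorphB /= horner_mx_X horner_mx_C.
by rewrite mulmxBl mul_scalar_mx memvB ?memvZ ?XU.
Qed.

(** The eigenspace of X within U is a nonzero submodule, hence U itself. *)
Lemma schur_scalar (U : {vspace 'cV[C]_N}) (X : 'M[C]_N) : irr U ->
  (forall v, v \in U -> X *m v \in U) ->
  (forall x v, x \in S -> v \in U -> X *m (psi x *m v) = psi x *m (X *m v)) ->
  exists c, forall v, v \in U -> X *m v = c *: v.
Proof.
move=> [nzU invU irrU] XU Xpsi.
have [c [v [vU nzv Xv]]] := eigenvector_in nzU XU; exists c.
pose W := (U :&: mxker (X - c%:M))%VS.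
have WE w : (w \in W) = (w \in U) && (X *m w == c *: w).
  by rewrite memv_cap mem_mxker mulmxBl mul_scalar_mx subr_eq0.
have [||W0|WU w wU] := irrU W.
- exact: capvSl.
- move=> x xS w; rewrite !WE => /andP[wU /eqP Xw].
  by apply/andP; split; [exact: invU | rewrite Xpsi // Xw -scalemxAr].
- have vW : v \in W by rewrite WE vU Xv eqxx.
  by move: vW; rewrite W0 memv0 (negPf nzv).
by move: wU; rewrite -WU WE => /andP[_ /eqP].
Qed.

(** The kernel of F in U and its image in V are submodules, so F is injective and onto. *)
Lemma intertwiner_equiv (U V : {vspace 'cV[C]_N}) (F : 'M[C]_N) :
  irr U -> irr V -> (forall v, v \in U -> F *m v \in V) ->
  (forall x, x \in S -> forall v, v \in U -> F *m (psi x *m v) = psi x *m (F *m v)) ->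
  (exists2 v, v \in U & F *m v != 0) -> equiv U V.
Proof.
move=> [nzU invU irrU] [nzV invV irrV] FUV Fpsi [v vU Fv].
pose f := linfun (mulmx F : 'cV[C]_N -> 'cV[C]_N).
have fE w : f w = F *m w by rewrite lfunE.
have ker0 : (U :&: lker f)%VS = 0%VS.
  have [||//|kU] := irrU (U :&: lker f)%VS; first exact: capvSl.
  - move=> x xS w; rewrite !memv_cap !memv_ker !fE => /andP[wU /eqP Fw].
    by rewrite invU //= Fpsi // Fw mulmx0.
  - by move: vU Fv; rewrite -kU memv_cap memv_ker fE => /andP[_ ->].
have imgV : (f @: U)%VS = V.
  have [||im0|//] := irrV (f @: U)%VS.
  - by apply/subvP => _ /memv_imgP[u uU ->]; rewrite fE FUV.
  - move=> x xS _ /memv_imgP[u uU ->]; rewrite fE -Fpsi // -fE.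
    by rewrite memv_img // invU.
  - by have := memv_img f vU; rewrite im0 memv0 fE (negPf Fv).
exists F; split=> //.
- move=> w wU Fw; apply/eqP; rewrite -memv0 -ker0 memv_cap wU memv_ker fE Fw.
  exact: eqxx.
- by rewrite -imgV limg_dim_eq.
Qed.

(** Schur's lemma applied to the endomorphism [T^-1 F] of U. *)
Lemma intertwiner_scalar (U V : {vspace 'cV[C]_N}) (F T : 'M[C]_N) :
  irr U ->
  (forall v, v \in U -> F *m v \in V) ->
  (forall x, x \in S -> forall v, v \in U -> F *m (psi x *m v) = psi x *m (F *m v)) ->
  [/\ forall v, v \in U -> T *m v \in V,
      forall v, v \in U -> T *m v = 0 -> v = 0, \dim U = \dim V &
      forall x, x \in S -> forall v, v \in U -> T *m (psi x *m v) = psi x *m (T *m v)] ->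
  exists c, forall v, v \in U -> F *m v = c *: (T *m v).
Proof.
move=> irrU FUV Fpsi [TUV Tinj dUV Tpsi].
have [_ invU _] := irrU.
have [T' T'P] := inverse_on TUV Tinj dUV.
have T'U v : v \in V -> T' *m v \in U by move=> /T'P[].
have TT' v : v \in V -> T *m (T' *m v) = v by move=> /T'P[].
have [||c cE] := @schur_scalar U (T' *m F) irrU.
- by move=> v vU; rewrite -mulmxA T'U // FUV.
- move=> x v xS vU; have xvU := invU x xS v vU.
  have FxV : psi x *m (F *m v) \in V by rewrite -Fpsi // FUV.
  rewrite -!mulmxA Fpsi //; apply/eqP; rewrite -subr_eq0; apply/eqP.
  apply: Tinj; first by rewrite memvB ?invU ?T'U ?FUV.
  by rewrite mulmxBr Tpsi ?T'U ?FUV // !TT' ?FUV // subrr.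
exists c => v vU; rewrite -[F *m v]TT' ?FUV // [T' *m _]mulmxA cE //.
by rewrite -scalemxAr.
Qed.

End Schur.

(** * Complete reducibility and lengths of chains of submodules *)

Section CompleteReducibility.
Variables (R : realType) (g : vectType R).
Local Notation C := (R[i]).
Variables (N : nat) (psi : g -> 'M[C]_N) (S : {vspace g}).
Local Notation inv := (Defs.invariant psi S).
Local Notation irr := (irreducible_sub psi S).

Lemma invariant_add U V : inv U -> inv V -> inv (U + V)%VS.
Proof.
move=> iU iV x xS _ /memv_addP[u uU [v vV ->]].
by rewrite mulmxDr memv_add ?iU ?iV.
Qed.

Lemma invariant_cap U V : inv U -> inv V -> inv (U :&: V)%VS.
Proof.
by move=> iU iV x xS u; rewrite !memv_cap => /andP[uU uV]; rewrite iU ?iV.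
Qed.

Lemma irreducible_meet W X : irr W -> inv X -> (W <= X)%VS \/ (W :&: X = 0)%VS.
Proof.
move=> [_ iW irrW] iX.
have [||->|E] := irrW (W :&: X)%VS; [exact: capvSl|exact: invariant_cap|by right|left].
by rewrite -E capvSr.
Qed.

(** The complement is orthogonal for the Hermitian form pulled back along P, realised as the kernel
    of a matrix with [\dim U] rows; rank-nullity shows that it is large enough. *)
Lemma invariant_complement U : unitarizable psi -> inv U ->
  exists V, [/\ inv V, (U + V)%VS = fullv & (U :&: V)%VS = 0%VS].
Proof.
move=> [m [P [Q [PQ QP skew]]]] iU.
pose b i := tnth (vbasis U) i.
pose A : 'M[C]_(\dim U, N) := \matrix_(i, j) (adjmx (P *m b i) *m P) 0 j.
have AE v : (v \in mxker A) <-> forall u, u \in U -> adjmx (P *m u) *m (P *m v) = 0.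
  rewrite mem_mxker; split=> [/eqP Av u uU|H]; last first.
    apply/eqP/matrixP => i j; rewrite ord1 [RHS]mxE mxE.
    have := H _ (vbasis_mem (mem_tnth i _)); rewrite mulmxA => /matrixP /(_ 0 0).
    rewrite mxE [X in _ = X -> _]mxE; apply: etrans; apply: eq_bigr => k _.
    by rewrite mxE.
  have bv i : adjmx (P *m b i) *m (P *m v) = 0.
    apply/matrixP => k l; rewrite !ord1 mulmxA [RHS]mxE mxE.
    have /matrixP /(_ i 0) := Av; rewrite mxE [X in _ = X -> _]mxE.
    by apply: etrans; apply: eq_bigr => j _; rewrite [in RHS]mxE.
  rewrite (coord_vbasis uU) mulmx_sumr adjmx_sum mulmx_suml big1 // => i _.
  by rewrite -scalemxAr adjmxZ -scalemxAl -tnth_nth bv scaler0.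
exists (mxker A).
have cap0 : (U :&: mxker A)%VS = 0%VS.
  apply/eqP; rewrite -subv0; apply/subvP => v; rewrite memv_cap memv0.
  move=> /andP[vU /AE /(_ v vU) H].
  have Pv : P *m v = 0 by apply: hs_eq0; rewrite /hs H mxtrace0.
  by rewrite -[v]mul1mx -QP -mulmxA Pv mulmx0.
split=> //.
  move=> x xS v /AE H; apply/AE => u uU.
  have E w : P *m (psi x *m w) = (P *m psi x *m Q) *m (P *m w).
    by rewrite !mulmxA -(mulmxA _ Q P) QP mulmx1.
  rewrite E mulmxA -[P *m psi x *m Q]adjmxK -adjmxM skew.
  by rewrite mulNmx adjmxN -E mulNmx H ?oppr0 // iU.
apply/eqP; rewrite eqEdim subvf /= dimv_disjoint_sum //.
have := limg_ker_dim (linfun (mulmx A : 'cV[C]_N -> 'cV[C]_(\dim U))) fullv.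
rewrite capfv -/(mxker A) => <-; rewrite addnC leq_add2r.
by apply: leq_trans (dimvS (subvf _)) _; rewrite dimvf dim_matrix; lia.
Qed.

(** Directness is recorded as additivity of dimensions, which survives concatenation of lists. *)
Lemma reducible_decomposition U : unitarizable psi -> inv U ->
  exists Us : seq {vspace 'cV[C]_N}, [/\ forall V, V \in Us -> irr V,
    (\sum_(V <- Us) V)%VS = U & (\sum_(V <- Us) \dim V)%N = \dim U].
Proof.
move=> unit; have [d] := ubnP (\dim U); elim: d U => // d IH U dU iU.
have [->|nzU] := eqVneq U 0%VS.
  by exists [::]; split=> //; rewrite !big_nil ?dimv0.
have [irrU|] := pselect (irr U).
  exists [:: U]; split=> [V||]; rewrite ?big_seq1 //.
  by rewrite inE => /eqP->.
move=> nirr.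
have [W [WU iW nW0 nWU]] : exists W, [/\ (W <= U)%VS, inv W, W != 0%VS & W != U].
  apply: contrapT => H; apply: nirr; split=> // W WU iW.
  apply: contrapT => /not_orP[/eqP W0 /eqP WnU]; apply: H.
  by exists W.
have [V [iV WV cWV]] := invariant_complement unit iW.
pose V' := (U :&: V)%VS.
have iV' : inv V' by apply: invariant_cap.
have sumU : (W + V')%VS = U.
  apply: subv_anti; apply/andP; split; first by rewrite subv_add WU capvSl.
  apply/subvP => u uU; have : u \in (W + V)%VS by rewrite WV memvf.
  case/memv_addP => w wW [v vV uE]; rewrite uE memv_add // memv_cap vV andbT.
  have -> : v = u - w by rewrite uE addrC addKr.
  by rewrite memvB // (subvP WU).
have cap0 : (W :&: V')%VS = 0%VS.
  by apply/eqP; rewrite -subv0 -cWV capvS // capvSr.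
have dsum : \dim U = (\dim W + \dim V')%N by rewrite -sumU dimv_disjoint_sum.
have dW0 : (0 < \dim W)%N by rewrite lt0n dimv_eq0.
have dV0 : (0 < \dim V')%N.
  rewrite lt0n dimv_eq0; apply/negP => /eqP V0.
  by move: nWU; rewrite -sumU V0 addv0 eqxx.
have [|Ws [Wirr WE Wd]] := IH W _ iW; first by move: dU dsum dV0; clear; lia.
have [|Vs [Virr VE Vd]] := IH V' _ iV'; first by move: dU dsum dW0; clear; lia.
exists (Ws ++ Vs); split.
- by move=> X; rewrite mem_cat => /orP[/Wirr|/Virr].
- by rewrite big_cat /= WE VE.
- by rewrite big_cat /= Wd Vd.
Qed.

(** Existence of a decomposition ensures that [the_decomp] is a genuine one and not merely the
    default [[::]]. *)
Lemma the_decompP : unitarizable psi -> irr_decomp psi S (the_decomp psi S).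
Proof.
move=> unit.
have [|Us [Uirr UE Ud]] := @reducible_decomposition fullv unit.
  by move=> x xS v _; exact: memvf.
have : irr_decomp psi S Us.
  by split=> //; rewrite directvE /= UE Ud.
by move=> dUs; apply: xgetPex; exists Us.
Qed.

Definition vlt (U V : {vspace 'cV[C]_N}) : bool := (U <= V)%VS && (U != V).

Lemma vlt_trans : transitive vlt.
Proof.
move=> V U W /andP[UV nUV] /andP[VW nVW]; apply/andP; split.
  exact: subv_trans VW.
apply/negP => /eqP UW; rewrite -UW in VW.
by move: nUV; rewrite eqEsubv UV VW.
Qed.

(** Adding W to a chain loses at most one inclusion. While W meets the terms trivially, dimensions
    keep the inclusions strict; one step may collapse at the first term containing W, and later
    terms do not change. *)
Lemma chain_drop W Z (Xs : seq {vspace 'cV[C]_N}) : irr W -> inv Z ->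
  path vlt Z Xs -> (forall X, X \in Xs -> inv X) ->
  exists Xs' : seq {vspace 'cV[C]_N}, [/\ path vlt (Z + W)%VS Xs',
    forall X, X \in Xs' -> inv X, (last (Z + W)%VS Xs' <= last Z Xs + W)%VS &
    (size Xs <= (size Xs').+1)%N].
Proof.
move=> irrW; have [_ iW _] := irrW.
elim: Xs Z => [|X Xs IH] Z iZ /=.
  by move=> _ _; exists [::]; split=> //=; exact: subvv.
move=> /andP[/andP[ZX nZX] pXs] iXs.
have iX : inv X by apply: iXs; exact: mem_head.
have iXs' Y : Y \in Xs -> inv Y by move=> YXs; apply: iXs; rewrite inE YXs orbT.
have [WZ|WZ] := irreducible_meet irrW iZ.
  exists (X :: Xs); rewrite (addv_idPl WZ); split=> //=.
  - by rewrite /vlt ZX nZX.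
  - exact: addvSl.
have [WX|WX] := irreducible_meet irrW iX.
  exists Xs; split=> //.
    have ZWX : (Z + W <= X)%VS by rewrite subv_add ZX WX.
    have [->//|nE] := eqVneq (Z + W)%VS X.
    by apply: path_le pXs; [exact: vlt_trans | rewrite /vlt ZWX nE].
  case: Xs {IH iXs iXs' pXs} => [|Y Ys] /=; last exact: addvSl.
  by rewrite addvS.
have [Xs' [p' i' l' s']] := IH X iX pXs iXs'.
exists ((X + W)%VS :: Xs'); split=> //=.
  rewrite p' andbT /vlt addvS //=; apply/negP => /eqP E.
  have /eqP : (\dim (Z + W) = \dim (X + W))%N by rewrite E.
  rewrite !dimv_disjoint_sum 1?capvC // eqn_add2r => /eqP dZX.
  by move: nZX; rewrite eqEdim ZX dZX leqnn.
by move=> Y; rewrite inE => /orP[/eqP->|/i' //]; exact: invariant_add.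
Qed.

(** The part of Jordan-Hölder needed here: absorbing the irreducible summands one at a time costs at
    most one inclusion each. *)
Lemma chain_le (Ws : seq {vspace 'cV[C]_N}) Z Xs :
  (forall W, W \in Ws -> irr W) -> inv Z -> path vlt Z Xs ->
  (forall X, X \in Xs -> inv X) ->
  (last Z Xs <= Z + \sum_(W <- Ws) W)%VS -> (size Xs <= size Ws)%N.
Proof.
elim: Ws Z Xs => [|W Ws IH] Z Xs irrWs iZ pXs iXs lXs.
  rewrite big_nil addv0 in lXs; case: Xs pXs iXs lXs => // X Xs /=.
  move=> pXs _ lXs; have /allP := order_path_min vlt_trans (pXs : path vlt Z (X :: Xs)).
  move=> /(_ (last X Xs) (mem_last _ _)) /andP[Zl nZl].
  by move: nZl; rewrite eqEsubv Zl lXs.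
have irrW := irrWs W (mem_head _ _); have [_ iW _] := irrW.
have [Xs' [p' i' l' s']] := chain_drop irrW iZ pXs iXs.
apply: leq_trans s' _; rewrite ltnS; apply: (IH (Z + W)%VS) => //.
- by move=> V VWs; apply: irrWs; rewrite inE VWs orbT.
- exact: invariant_add.
- apply: subv_trans l' _; rewrite subv_add; apply/andP; split.
    by apply: subv_trans lXs _; rewrite big_cons addvA subvv.
  by apply: subv_trans (addvSr Z W) (addvSl _ _).
Qed.

End CompleteReducibility.

Section DirectChain.
Variables (K : fieldType) (vT : vectType K).

Lemma dim_bigaddv (Us : seq {vspace vT}) :
  (\dim (\sum_(U <- Us) U) <= \sum_(U <- Us) \dim U)%N.
Proof.
elim: Us => [|U Us IH]; first by rewrite !big_nil dimv0.
by rewrite !big_cons; apply: leq_trans (dimv_add_leqif _ _) _; rewrite leq_add2l.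
Qed.

End DirectChain.

(** Additivity of dimension for the whole sum forces it for every prefix, so each nonzero summand
    enlarges the partial sum. *)
Lemma direct_chain (R : realType) N (Us : seq {vspace 'cV[R[i]]_N})
    (Z : {vspace 'cV[R[i]]_N}) :
  \dim (Z + \sum_(U <- Us) U) = (\dim Z + \sum_(U <- Us) \dim U)%N ->
  (forall U, U \in Us -> U != 0%VS) -> path (@vlt R N) Z (scanl addv Z Us).
Proof.
elim: Us Z => //= U Us IH Z; rewrite !big_cons => dE nz.
have dZU : \dim (Z + U) = (\dim Z + \dim U)%N.
  apply/eqP; rewrite eqn_leq dimv_add_leqif /=.
  have h2 := (dimv_add_leqif (Z + U)%VS (\sum_(j <- Us) j)%VS).1.
  have h1 := dim_bigaddv Us; rewrite -addvA dE in h2; move: h1 h2; clear; lia.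
apply/andP; split.
  rewrite /vlt addvSl /=; apply/negP => /eqP E.
  have := nz U (mem_head _ _); rewrite -dimv_eq0.
  by move: dZU; rewrite -E => /eqP; rewrite -{1}[\dim Z]addn0 eqn_add2l => /eqP <-.
apply: IH; first by rewrite -addvA dE dZU addnA.
by move=> V VUs; apply: nz; rewrite inE VUs orbT.
Qed.

Lemma mulmx_cV_inj (K : fieldType) m n (A B : 'M[K]_(m, n)) :
  (forall v : 'cV_n, A *m v = B *m v) -> A = B.
Proof.
move=> H; apply/matrixP => i j; have := H (delta_mx j 0).
by rewrite -!colE => /matrixP /(_ i 0); rewrite !mxE.
Qed.

(** * The two norms and the commutant *)

Section Norms.
Variables (R : realType) (g : vectType R).
Local Notation C := (R[i]).
Variables (N : nat) (psi : g -> 'M[C]_N).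

(** Every property, including commutation with psi, follows from uniqueness of components in a
    direct sum. *)
Lemma decomp_projections (S : {vspace g}) Us : irr_decomp psi S Us ->
  exists P : 'I_(size Us) -> 'M[C]_N,
  [/\ forall i (v : 'cV[C]_N), P i *m v \in nth 0%VS Us i,
      forall v : 'cV[C]_N, \sum_i P i *m v = v,
      forall (i j : 'I_(size Us)) v, v \in nth 0%VS Us i ->
        P j *m v = if j == i then v else 0 &
      forall i x (v : 'cV[C]_N), x \in S -> P i *m (psi x *m v) = psi x *m (P i *m v)].
Proof.
move=> [Uirr].
rewrite [X in _ -> X = _ -> _](big_nth 0%VS) big_mkord => dU sU.
have {}dU : directv (\sum_(i < size Us) nth 0%VS Us i).
  move: dU; rewrite !directvE /= !(big_nth 0%VS) !big_mkord //.
have uniq_sum := directv_sum_unique dU.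
have [P PE] := choice (fun i => mx_of_lfun (sumv_pi_for (esym sU) i)).
have PU i v : P i *m v \in nth 0%VS Us i by rewrite PE memv_sum_pi.
have Psum (v : 'cV_N) : \sum_i P i *m v = v.
  rewrite (eq_bigr _ (fun i _ => PE i v)).
  by apply: sumv_pi_sum; exact: memvf.
exists P; split=> //.
- move=> i j v vU.
  have := uniq_sum (fun k => P k *m v) (fun k => if k == i then v else 0).
  rewrite Psum -big_mkcond /= big_pred1_eq eqxx.
  move=> H; have /forallP /(_ j) /eqP -> // :
    [forall k, P k *m v == if k == i then v else 0].
  rewrite -H // => k _; case: eqP => [->//|_]; exact: mem0v.
- move=> i x v xS.
  have := uniq_sum (fun k => P k *m (psi x *m v)) (fun k => psi x *m (P k *m v)).
  rewrite Psum -mulmx_sumr Psum eqxx.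
  move=> H; have /forallP /(_ i) /eqP -> // :
    [forall k, P k *m (psi x *m v) == psi x *m (P k *m v)].
  rewrite -H // => k _.
  by have [_ invk _] := Uirr _ (mem_nth 0%VS (ltn_ord k)); exact: invk.
Qed.

(** A basis of the commutant: for each ordered pair of equivalent summands, project onto the first
    and apply a fixed equivalence to the second. *)
Lemma dim_commutant (S : {vspace g}) : unitarizable psi ->
  dim_set (commutant psi S) = norm2 psi S.
Proof.
move=> /(the_decompP S); rewrite /norm2; move: (the_decomp psi S) => Us dUs.
have [P [PU Psum Pid Ppsi]] := decomp_projections dUs.
have [Uirr _ _] := dUs.
pose U (i : 'I_(size Us)) := nth 0%VS Us i.
have irrU (i : 'I_(size Us)) : irreducible_sub psi S (U i) by apply/Uirr/mem_nth.
have /choice[T TP] (p : 'I_(size Us) * 'I_(size Us)) : exists T : 'M[C]_N,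
  equiv_sub psi S (U p.1) (U p.2) ->
  [/\ forall v, v \in U p.1 -> T *m v \in U p.2,
      forall v, v \in U p.1 -> T *m v = 0 -> v = 0,
      \dim (U p.1) = \dim (U p.2) &
      forall x, x \in S -> forall v, v \in U p.1 ->
        T *m (psi x *m v) = psi x *m (T *m v)].
  have [[T0 TP]|nE] := pselect (equiv_sub psi S (U p.1) (U p.2)).
    by exists T0.
  by exists 0.
pose r := [seq p : 'I_(size Us) * 'I_(size Us) <- index_enum _ |
  `[< equiv_sub psi S (U p.1) (U p.2) >]].
have rP p : p \in r -> equiv_sub psi S (U p.1) (U p.2).
  by rewrite mem_filter => /andP[/asboolP].
have ur : uniq r by rewrite filter_uniq // index_enum_uniq.
pose E (p : 'I_(size Us) * 'I_(size Us)) := T p *m P p.1.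
rewrite (@dim_setE _ _ _ [seq E p | p <- r]).
- rewrite size_map size_filter -sum1_count.
  rewrite pair_big /= [LHS]big_mkcond /=; apply: eq_bigr => p _.
  by case: `[< _ >].
- apply: free_map => // k k0 p pr.
  have [_ Tinj _ _] := TP _ (rP _ pr).
  have [nzU _ _] := irrU p.1.
  have vU := memv_pick (U p.1); move: nzU; rewrite -vpick0; set v := vpick _ in vU * => nzv.
  (* Evaluating at a nonzero v of the source summand keeps only the pairs that start there;
     projecting to the target of p then isolates its coefficient. *)
  have sum0 : \sum_(q <- r | q.1 == p.1) k q *: (T q *m v) = 0.
    rewrite -[RHS](mul0mx _ v) -k0 mulmx_suml big_mkcond; apply: eq_bigr => q _.
    rewrite -scalemxAl /E -mulmxA (Pid p.1 q.1 v vU).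
    by case: eqP => // _; rewrite mulmx0 scaler0.
  have : P p.2 *m (\sum_(q <- r | q.1 == p.1) k q *: (T q *m v)) = k p *: (T p *m v).
    have pr' : p \in [seq q <- r | q.1 == p.1] by rewrite mem_filter eqxx pr.
    have ur' : uniq [seq q <- r | q.1 == p.1] by apply: filter_uniq.
    rewrite mulmx_sumr -big_filter (bigD1_seq p pr' ur') /=.
    rewrite big_seq_cond big1 => [|q].
      have [TU _ _ _] := TP _ (rP _ pr).
      by rewrite addr0 -scalemxAr (Pid p.2) ?eqxx // TU.
    rewrite mem_filter => /andP[/andP[/eqP q1 qr] qp].
    have [TU _ _ _] := TP _ (rP _ qr).
    rewrite -scalemxAr (Pid q.2) ?TU ?q1 //; case: eqP => [q2|_].
      by move: qp; rewrite [q]surjective_pairing q1 -q2 -surjective_pairing eqxx.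
    by rewrite scaler0.
  rewrite sum0 mulmx0 => /esym/eqP; rewrite scaler_eq0 => /orP[/eqP//|/eqP Tv].
  by rewrite (Tinj v vU Tv) eqxx in nzv.
- move=> _ /mapP[p pr ->] x xS.
  have [_ _ _ Tpsi] := TP _ (rP _ pr).
  by apply: mulmx_cV_inj => v; rewrite /E -!mulmxA Ppsi // Tpsi // PU.
move=> X comX.
have block_scalar p : exists c : C, p \in r ->
    forall v, v \in U p.1 -> P p.2 *m (X *m v) = c *: (T p *m v).
  have [pr|] := boolP (p \in r); last by exists 0.
  have [||c cE] := @intertwiner_scalar _ _ _ psi S _ _ (P p.2 *m X) (T p)
    (irrU p.1) _ _ (TP _ (rP _ pr)).
  - by move=> v _; rewrite -mulmxA PU.
  - move=> x xS v _; rewrite -!mulmxA [X *m (_ *m _)]mulmxA (comX x xS) -mulmxA.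
    exact: Ppsi.
  - by exists c => _ v vU; rewrite mulmxA cE.
have [c cP] := choice block_scalar.
have -> : X = \sum_(p <- r) c p *: E p.
  apply: mulmx_cV_inj => v; rewrite mulmx_suml.
  transitivity (\sum_i \sum_j P j *m (X *m (P i *m v))).
    rewrite -{1}(Psum v) mulmx_sumr; apply: eq_bigr => i _.
    by rewrite Psum.
  rewrite pair_big /= big_filter [RHS]big_mkcond; apply: eq_bigr => p _.
  case: asboolP => [Ep|nE].
    have pr : p \in r by rewrite mem_filter mem_index_enum andbT; apply/asboolP.
    by rewrite cP ?PU // -scalemxAl /E mulmxA.
  (* A nonzero block of X between two summands would be an intertwiner, hence an equivalence. *)
  apply/eqP; apply: contrapT => /negP nz; apply: nE.
  apply: (@intertwiner_equiv _ _ _ psi S _ _ (P p.2 *m X)) => //.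
  - by move=> w _; rewrite -mulmxA PU.
  - move=> x xS w _; rewrite -!mulmxA [X *m (_ *m _)]mulmxA (comX x xS) -mulmxA.
    exact: Ppsi.
  - by exists (P p.1 *m v); rewrite ?PU // -mulmxA.
rewrite big_seq memv_suml // => p pr; rewrite memvZ // memv_span //.
exact: map_f.
Qed.

(* The common consequence of the numerical conditions from which h = g follows. *)
Definition controls (h : {vspace g}) : Prop := forall X : 'M[C]_N,
  (forall U, Defs.invariant psi fullv U -> forall v, v \in U -> X *m v \in U) ->
  (forall y, y \in h -> X *m psi y = psi y *m X) ->
  forall x, X *m psi x = psi x *m X.

Lemma commutant_vspace (S : {vspace g}) :
  exists U : {vspace 'M[C]_N}, forall X, X \in U <-> commutant psi S X.
Proof.
apply: vspace_of_submod => [x _|a X Y cX cY x xS]; first by rewrite mul0mx mulmx0.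
by rewrite mulmxDl mulmxDr -scalemxAl -scalemxAr cX // cY.
Qed.

(** The commutant of g lies in that of h, so equal dimensions make them equal. *)
Lemma controls_of_dim (h : {vspace g}) :
  dim_set (commutant psi h) = dim_set (commutant psi fullv) -> controls h.
Proof.
have [U UE] := commutant_vspace h; have [V VE] := commutant_vspace fullv.
rewrite (dim_set_vspace UE) (dim_set_vspace VE) => dUV X _ Xh x.
have VU : (V <= U)%VS.
  by apply/subvP => Y /VE cY; apply/UE => y _; apply: cY; exact: memvf.
have /eqP E : V == U by rewrite eqEdim VU dUV leqnn.
have /VE : X \in V by rewrite E; apply/UE.
by apply; exact: memvf.
Qed.

Lemma controls_of_norm1 (h : {vspace g}) : unitarizable psi ->
  norm1 psi h = norm1 psi fullv -> controls h.
Proof.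
move=> unit n1.
have [Wirr _ Wfull] := the_decompP h unit.
have [Uirr Udir Ufull] := the_decompP fullv unit.
move: n1 Wirr Wfull Uirr Udir Ufull; rewrite /norm1.
move: (the_decomp psi h) (the_decomp psi fullv) => Ws Us sWU Wirr Wfull Uirr Udir Ufull.
have inv_h U : Defs.invariant psi fullv U -> Defs.invariant psi h U.
  by move=> iU x _; apply: iU; exact: memvf.
have Uirr_h U : U \in Us -> irreducible_sub psi h U.
  move=> Uin; have [nzU iU _] := Uirr U Uin.
  split=> //; first exact: inv_h.
  move=> W WU iW; apply: contrapT => /not_orP[/eqP nzW /eqP nWU].
  (* With U moved to the front, W refines the partial sums to a chain of h-submodules with one step
     more than the number of h-irreducible summands, which [chain_le] forbids. *)
  have perm := perm_to_rem Uin; set Us' := rem U Us in perm.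
  have Us'P V : V \in Us' -> V \in Us by move=> VUs; rewrite (perm_mem perm) inE VUs orbT.
  have dE : \dim (U + \sum_(V <- Us') V) = (\dim U + \sum_(V <- Us') \dim V)%N.
    have := Udir; rewrite directvE /= => /eqP.
    by rewrite !(perm_big _ perm) /= !big_cons.
  have chain := direct_chain dE
    (fun V VUs => let: And3 nz _ _ := Uirr V (Us'P V VUs) in nz).
  have := @chain_le _ _ _ psi h Ws 0%VS (W :: U :: scanl addv U Us') Wirr.
  rewrite add0v Wfull /= size_scanl sWU (perm_size perm) /= ltnn.
  move=> H; suff : false by []; apply: H.
  - by move=> x xh v; rewrite !memv0 => /eqP ->; rewrite mulmx0.
  - by rewrite chain andbT /vlt sub0v eq_sym nzW WU nWU.
  - move=> X; rewrite !inE => /or3P[/eqP->//|/eqP->|]; first exact: inv_h.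
    have : forall Z, Defs.invariant psi h Z -> X \in scanl addv Z Us' ->
        Defs.invariant psi h X.
      elim: (Us') Us'P => //= V Vs IH VsP Z iZ; rewrite inE => /orP[/eqP->|].
        apply: invariant_add => //; apply: inv_h.
        by have [] := Uirr V (VsP V (mem_head _ _)).
      apply: IH => [Y YVs|]; first by apply: VsP; rewrite inE YVs orbT.
      apply: invariant_add => //; apply: inv_h.
      by have [] := Uirr V (VsP V (mem_head _ _)).
    by apply; exact: inv_h.
  - exact: subvf.
move=> X Xinv Xh x.
have Xscal U : U \in Us -> exists c, forall v, v \in U -> X *m v = c *: v.
  move=> Uin; have [_ iU _] := Uirr U Uin.
  apply: (schur_scalar (Uirr_h U Uin)); first exact: Xinv.
  by move=> y v yh _; rewrite mulmxA Xh // -mulmxA.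
have commU (v : 'cV_N) : X *m (psi x *m v) = psi x *m (X *m v).
  have : v \in (\sum_(U <- Us) U)%VS by rewrite Ufull memvf.
  rewrite big_tnth => /memv_sumP[u uU ->].
  rewrite !mulmx_sumr; apply: eq_bigr => i _.
  have Uin := mem_tnth i (in_tuple Us); have [_ iU _] := Uirr _ Uin.
  have [c cE] := Xscal _ Uin.
  by rewrite !cE ?uU // -?scalemxAr // iU ?memvf ?uU.
by apply: mulmx_cV_inj => v; rewrite -!mulmxA.
Qed.

End Norms.

(** * Tensor squares *)

Section TensorProduct.
Variables (K : comPzRingType) (m n p q : nat).

Lemma tensmxDl (A B : 'M[K]_(m, n)) (D : 'M[K]_(p, q)) :
  (A + B) *t D = A *t D + B *t D.
Proof. by apply/matrixP => i j; rewrite !mxE mulrDl. Qed.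

Lemma tensmxDr (A : 'M[K]_(m, n)) (D E : 'M[K]_(p, q)) :
  A *t (D + E) = A *t D + A *t E.
Proof. by apply/matrixP => i j; rewrite !mxE mulrDr. Qed.

Lemma tensmxNl (A : 'M[K]_(m, n)) (D : 'M[K]_(p, q)) : (- A) *t D = - (A *t D).
Proof. by apply/matrixP => i j; rewrite !mxE mulNr. Qed.

Lemma tensmxNr (A : 'M[K]_(m, n)) (D : 'M[K]_(p, q)) : A *t (- D) = - (A *t D).
Proof. by apply/matrixP => i j; rewrite !mxE mulrN. Qed.

Lemma tensmxZl a (A : 'M[K]_(m, n)) (D : 'M[K]_(p, q)) :
  (a *: A) *t D = a *: (A *t D).
Proof. by apply/matrixP => i j; rewrite !mxE mulrA. Qed.

Lemma tensmxZr a (A : 'M[K]_(m, n)) (D : 'M[K]_(p, q)) :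
  A *t (a *: D) = a *: (A *t D).
Proof. by apply/matrixP => i j; rewrite !mxE mulrCA. Qed.

End TensorProduct.

Lemma mxtrace_tens (K : comPzRingType) m n (A : 'M[K]_m) (B : 'M[K]_n) :
  \tr (A *t B) = \tr A * \tr B.
Proof.
by rewrite /mxtrace mulr_sum; apply: eq_bigr => i _; rewrite mxE.
Qed.

(** * The trace form and the recovery of h *)

Section TensorSquare.
Variables (R : realType) (g : vectType R) (br : g -> g -> g).
Local Notation C := (R[i]).

Lemma is_rep_tens m n (phi : g -> 'M[C]_m) (chi : g -> 'M[C]_n) :
  is_rep br phi -> is_rep br chi -> is_rep br (tens_rep phi chi).
Proof.
move=> [pD pZ pb] [cD cZ cb]; split=> [x y|a x|x y]; rewrite /tens_rep.
- by rewrite pD cD tensmxDl tensmxDr addrACA.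
- by rewrite pZ cZ tensmxZl tensmxZr scalerDr.
rewrite pb cb tensmxDl tensmxDr tensmxNl tensmxNr.
rewrite !mulmxDl !mulmxDr !tensmx_mul !mul1mx !mulmx1.
by apply/matrixP => i j; rewrite !mxE; ring.
Qed.

Lemma is_rep_dual n (phi : g -> 'M[C]_n) :
  is_rep br phi -> is_rep br (dual_rep phi).
Proof.
move=> [pD pZ pb]; split=> [x y|a x|x y]; rewrite /dual_rep.
- by rewrite pD linearD opprD.
- by rewrite pZ linearZ scalerN.
by rewrite pb linearB /= !trmx_mul !mulNmx !mulmxN !opprK opprB.
Qed.

Hypothesis lie : is_lie_bracket br.
Hypothesis cs : compact_semisimple br.

Lemma mxtrace_rep n (phi : g -> 'M[C]_n) x : is_rep br phi -> \tr (phi x) = 0.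
Proof.
move=> rphi; move: x; apply: (perfect_ind lie cs).
- by rewrite (rep0 rphi) mxtrace0.
- by move=> a x y hx hy; rewrite (repP rphi) mxtraceD mxtraceZ hx hy mulr0 addr0.
by move=> x y; rewrite (repbr rphi) raddfB /= mxtrace_mulC subrr.
Qed.

Lemma compact_unitarizable n (phi : g -> 'M[C]_n) :
  is_rep br phi -> unitarizable phi.
Proof.
have [[B [B1 B2 B3 B4]] ss] := cs.
have ipB : inner_product B by split.
exact: (rep_unitarizable lie ss ipB B4).
Qed.

(** The sign makes the form positive: for a skew-Hermitian matrix U, [- \tr (U *m U)] is the squared
    norm of U. *)
Definition trace_form n (phi : g -> 'M[C]_n) x y : R :=
  - Re (\tr (phi x *m phi y)).

(** In a skew-Hermitian realisation, conjugating the trace only reverses the product, so the trace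
    is real. *)
Lemma trace_formE n (phi : g -> 'M[C]_n) x y : is_rep br phi ->
  \tr (phi x *m phi y) = - (trace_form phi x y)%:C%C.
Proof.
move=> /compact_unitarizable [m [P [Q [PQ QP skew]]]].
have E : \tr (phi x *m phi y) = \tr ((P *m phi x *m Q) *m (P *m phi y *m Q)).
  rewrite -(mulmxA (P *m _)) (mulmxA Q) (mulmxA Q) QP mul1mx -!mulmxA [RHS]mxtrace_mulC.
  by rewrite -!mulmxA QP mulmx1.
have : conjc (\tr (phi x *m phi y)) = \tr (phi x *m phi y).
  by rewrite E -mxtrace_adj adjmxM !skew mulNmx mulmxN opprK mxtrace_mulC.
rewrite /trace_form rmorphN opprK; case: (\tr _) => a b [hb].
by have -> : b = 0 by move: hb; lra.
Qed.

Lemma trace_form_ip n (phi : g -> 'M[C]_n) : is_rep br phi -> faithful phi ->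
  inner_product (trace_form phi).
Proof.
move=> rphi finj; split=> [a x y z|x y|x nzx].
- apply: complexI; apply: oppr_inj; rewrite -trace_formE //.
  rewrite (repP rphi) mulmxDl -scalemxAl mxtraceD mxtraceZ !trace_formE //.
  by rewrite rmorphD rmorphM opprD mulrN.
- by rewrite /trace_form mxtrace_mulC.
have [m [P [Q [PQ QP skew]]]] := compact_unitarizable rphi.
pose U := P *m phi x *m Q.
have E : (trace_form phi x x)%:C%C = hs U U.
  rewrite -[LHS]opprK -trace_formE // /hs skew mulNmx raddfN /=; congr (- _).
  rewrite -(mulmxA (P *m _)) (mulmxA Q) (mulmxA Q) QP mul1mx -!mulmxA [RHS]mxtrace_mulC.
  by rewrite -!mulmxA QP mulmx1.
have nzU : U != 0.
  apply: contra nzx => /eqP U0; apply/eqP/finj; rewrite (rep0 rphi).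
  have : Q *m U *m P = phi x by rewrite /U !mulmxA QP mul1mx -mulmxA QP mulmx1.
  by rewrite U0 mulmx0 mul0mx => <-.
rewrite -ltcR E lt_neqAle hs_ge0 andbT eq_sym; apply: contra nzU => /eqP /hs_eq0 ->.
exact: eqxx.
Qed.

Lemma trace_form_inv n (phi : g -> 'M[C]_n) x y z : is_rep br phi ->
  trace_form phi (br x y) z = trace_form phi x (br y z).
Proof.
move=> rphi; rewrite /trace_form !(repbr rphi) mulmxBl mulmxBr !raddfB /=.
by rewrite -!mulmxA (mxtrace_mulC (phi y)) -!mulmxA.
Qed.

(** Of the four terms, those with a and b in the same slot carry the factor [\tr (chi y)] or
    [\tr (phi z)], which is zero. *)
Lemma tens_trace m n (phi : g -> 'M[C]_m) (chi : g -> 'M[C]_n) a b y z :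
  is_rep br phi -> is_rep br chi ->
  \tr ((phi z *t chi y) *m (tens_rep phi chi a *m tens_rep phi chi b)) =
  \tr (phi z *m phi a) * \tr (chi y *m chi b) +
  \tr (phi z *m phi b) * \tr (chi y *m chi a).
Proof.
move=> rphi rchi; rewrite /tens_rep !mulmxDl !mulmxDr !tensmx_mul !mulmx1 !mul1mx.
rewrite !mxtraceD !mxtrace_tens (mxtrace_rep y rchi) (mxtrace_rep z rphi).
by rewrite !mulr0 !mul0r add0r addr0.
Qed.

(** The second factor chi enters through its trace form, which covers both phi and its dual. *)
Lemma controls_full n (h : {vspace g}) (phi chi : g -> 'M[C]_n) :
  lie_subalgebra br h -> is_rep br phi -> faithful phi -> is_rep br chi ->
  (forall x y, \tr (chi x *m chi y) = \tr (phi x *m phi y)) ->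
  controls (tens_rep phi chi) h -> h = fullv.
Proof.
move=> hbr rphi finj rchi trE ctrl.
have ipt := trace_form_ip rphi finj; set tau := trace_form phi in ipt.
have rpsi := is_rep_tens rphi rchi; set psi := tens_rep phi chi in rpsi ctrl.
have trpsi a b y z : \tr ((phi z *t chi y) *m (psi a *m psi b)) =
    \tr (phi z *m phi a) * \tr (phi y *m phi b) +
    \tr (phi z *m phi b) * \tr (phi y *m phi a).
  by rewrite tens_trace // !trE.
have trpsi1 w : \tr ((phi w *t (1%:M : 'M_n)) *m psi w) =
    \tr (phi w *m phi w) * n%:R.
  rewrite /psi /tens_rep mulmxDr !tensmx_mul mxtraceD !mxtrace_tens.
  by rewrite !mulmx1 mul1mx (mxtrace_rep w rchi) mulr0 addr0 mxtrace1.
clearbody psi.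
have tauE x y : \tr (phi x *m phi y) = - (tau x y)%:C%C by exact: trace_formE.
have tauI x y z : tau (br x y) z = tau x (br y z) by exact: trace_form_inv.
clearbody tau.
have [s [sh sE]] := ip_frame ipt h.
(* the Casimir element of h for the trace form *)
pose Q := \sum_(f <- s) psi f *m psi f.
have Qbr x : psi x *m Q - Q *m psi x =
    \sum_(f <- s) (psi (br x f) *m psi f + psi f *m psi (br x f)).
  rewrite mulmx_sumr mulmx_suml -sumrB; apply: eq_bigr => f _.
  by rewrite (repbr rpsi) mulmxBl mulmxBr !mulmxA addrA subrK.
have Qh y : y \in h -> Q *m psi y = psi y *m Q.
  move=> yh; apply/eqP; rewrite eq_sym -subr_eq0 Qbr big_split /=.
  have := @skew_frame_sum R g tau ipt _ h s (br y) (fun u v => psi u *m psi v) sh sE.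
  move=> ->; rewrite ?subrr //.
  - by move=> x; apply: hbr.
  - move=> u v _ _; rewrite (lieC lie) (ipNl ipt); congr (- _).
    exact: tauI.
  - by move=> a u v w; rewrite (repP rpsi) mulmxDl -scalemxAl.
  - by move=> a u v w; rewrite (repP rpsi) mulmxDr -scalemxAr.
(* Q is a polynomial in operators psi, so it preserves every submodule for g. *)
have Qg : forall x, Q *m psi x = psi x *m Q.
  apply: ctrl => // U iU v vU; rewrite mulmx_suml memv_suml // => f _.
  by rewrite -mulmxA !iU ?memvf.
have hperp x : (forall u, u \in h -> tau x u = 0) -> x = 0.
  move=> xh.
  (* Pair [[psi x, Q] = 0] with [phi z *t chi y] for [z = br x y]. As x is orthogonal to h, half of
     the terms vanish; the others sum to [2 tau z z] by expanding y in the frame. *)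
  have comm y : y \in h -> br x y = 0.
    move=> yh; apply: (ip_eq0 ipt); set z := br x y.
    have := congr1 (fun A => \tr ((phi z *t chi y) *m A)) (Qbr x).
    rewrite Qg subrr mulmx0 mxtrace0 mulmx_sumr (raddf_sum (@mxtrace _ _)) /=.
    have -> : \sum_(f <- s) \tr ((phi z *t chi y) *m
        (psi (br x f) *m psi f + psi f *m psi (br x f))) =
        ((\sum_(f <- s) tau y f * tau z (br x f)) *+ 2)%:C%C.
      rewrite -sumrMnl rmorph_sum !big_seq; apply: eq_bigr => f fs.
      rewrite mulmxDr mxtraceD !trpsi !tauE.
      have -> : tau y (br x f) = 0.
        rewrite -tauI (lieC lie) (ipNl ipt) tauI xh ?oppr0 //.
        by apply: hbr => //; exact: sh.
      rewrite rmorph0 oppr0 !mulr0 addr0 add0r !mulrNN -mulr2n rmorphMn rmorphM.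
      by rewrite mulrC.
    move=> /esym/complexI/eqP; rewrite mulrn_eq0 /= => /eqP <-.
    have linz (r : seq g) : tau z (br x (\sum_(f <- r) tau y f *: f)) =
        \sum_(f <- r) tau y f * tau z (br x f).
      elim: r => [|f r IHr]; first by rewrite !big_nil (lie0r lie) (ip_sym ipt) (ip0l ipt).
      rewrite !big_cons; have [_ -> _ _] := lie.
      by rewrite (ipDr ipt) (ipZr ipt) IHr.
    by rewrite -linz -sE.
  apply: (semisimple_centerless lie) => [|y]; first by case: cs.
  have : psi x *m psi y = psi y *m psi x.
    apply: (ctrl (psi x)) => [U iU v vU|u uh].
      by apply: iU => //; exact: memvf.
    by apply/eqP; rewrite -subr_eq0 -(repbr rpsi) comm // (rep0 rpsi).
  move=> /eqP; rewrite -subr_eq0 -(repbr rpsi) => /eqP; set w := br x y => psiw.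
  apply: (ip_eq0 ipt).
  (* This pairing recovers n times the trace form of w from psi w; for n = 0 the trace is an empty
     sum. *)
  have := congr1 (fun A => \tr ((phi w *t (1%:M : 'M_n)) *m A)) psiw.
  rewrite mulmx0 mxtrace0 trpsi1 => /eqP.
  rewrite mulf_eq0 pnatr_eq0 => /orP[/eqP E|/eqP n0].
    by apply: complexI; apply: oppr_inj; rewrite -tauE E rmorph0 oppr0.
  apply: complexI; apply: oppr_inj; rewrite -tauE rmorph0 oppr0.
  by rewrite /mxtrace big1 // => i _; have := ltn_ord i; rewrite {2}n0.
apply/eqP; rewrite eqEsubv subvf; apply/subvP => v _.
have [y [z [-> yh zh]]] := ip_split ipt h v.
by rewrite (hperp z zh) addr0.
Qed.

Lemma restriction_full n (h : {vspace g}) (phi chi : g -> 'M[C]_n) :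
  lie_subalgebra br h -> is_rep br phi -> faithful phi -> is_rep br chi ->
  (forall x y, \tr (chi x *m chi y) = \tr (phi x *m phi y)) ->
  let psi := tens_rep phi chi in
  [/\ dim_set (commutant psi h) = dim_set (commutant psi fullv) -> h = fullv,
      norm2 psi h = norm2 psi fullv -> h = fullv &
      norm1 psi h = norm1 psi fullv -> h = fullv].
Proof.
move=> hbr rphi finj rchi trE psi.
have upsi : unitarizable psi by apply: compact_unitarizable; apply: is_rep_tens.
have full := controls_full hbr rphi finj rchi trE.
split=> [/controls_of_dim|n2|/(controls_of_norm1 upsi)]; try exact: full.
by apply/full/controls_of_dim; rewrite !dim_commutant.
Qed.

End TensorSquare.

(** * The equivalences *)

Theorem theorem8 (R : realType) (g : vectType R) (br : g -> g -> g)
  (h : {vspace g}) (n : nat) (phi : g -> 'M[R[i]]_n) :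
  is_lie_bracket br -> compact_semisimple br ->
  lie_subalgebra br h ->
  is_rep br phi -> faithful phi ->
  let pp := tens_rep phi phi in
  let pd := tens_rep phi (dual_rep phi) in
  [<-> h = fullv;
       dim_set (commutant pd h) = dim_set (commutant pd fullv);
       dim_set (commutant pp h) = dim_set (commutant pp fullv);
       norm2 pd h = norm2 pd fullv;
       norm1 pd h = norm1 pd fullv;
       norm2 pp h = norm2 pp fullv;
       norm1 pp h = norm1 pp fullv].
Proof.
move=> lie cs hbr rphi finj pp pd.
have [pp0 pp2 pp1] := restriction_full lie cs hbr rphi finj rphi (fun _ _ => erefl).
have trE x y : \tr (dual_rep phi x *m dual_rep phi y) = \tr (phi x *m phi y).
  rewrite /dual_rep mulNmx mulmxN opprK -trmx_mul mxtrace_tr mxtrace_mulC //.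
have [pd0 pd2 pd1] := restriction_full lie cs hbr rphi finj (is_rep_dual rphi) trE.
(* Each arrow of the cycle first recovers [h = fullv], after which the next equality is
   immediate. *)
tfae.
- by move=> ->.
- by move=> /pd0 ->.
- by move=> /pp0 ->.
- by move=> /pd2 ->.
- by move=> /pd1 ->.
- by move=> /pp2 ->.
- exact: pp1.
Qed.
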